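(* Let $h_M>0$, let $A \subset \mathbb{R}^r$, and let $f : A \times \mathcal{C}^0([-h_M,0];\mathbb{R}^n) \rightarrow \mathbb{R}^n$ be a continuous function such that $f(\cdot,0)=0$ and $f$ is locally Lipschitz continuous with respect to the second argument. Let $\mathcal{H}$ be any subset of $\mathcal{C}^0(\mathbb{R}_+; \mathbb{R}^r)$ that is forward invariant and that satisfies $\zeta(t) \in A$ for all $\zeta \in \mathcal{H}$ and all $t \geq 0$. Consider the retarded differential equation $$\dot{x}(t) = f(\zeta(t),x_t), \quad t \geq 0, \qquad x(\tau) = x_0(\tau), \quad \tau\in[-h_M,0],$$ where $x_0 \in \mathcal{C}^0([-h_M,0];\mathbb{R}^n)$ and $\zeta \in \mathcal{H}$. For a given $H > 0$, assume that the restriction of $f$ to $A \times \{ \phi \in \mathcal{C}^0([-h_M,0];\mathbb{R}^n) : \Vert \phi \Vert_\infty \leq H \}$ is Lipschitz continuous with respect to the second argument, uniformly with respect to the first argument. Then the following hold for this system: (i) $(W,\mathcal{H})$-stability $\Leftrightarrow$ $(\mathcal{C}^0([-h_M,0];\mathbb{R}^n),\mathcal{H})$-stability; (ii) $(W,\mathcal{H})$-local uniform asymptotic stability $\Leftrightarrow$ $(\mathcal{C}^0([-h_M,0];\mathbb{R}^n),\mathcal{H})$-local uniform asymptotic stability; (iii) $(W,\mathcal{H})$-local exponential stability $\Leftrightarrow$ $(\mathcal{C}^0([-h_M,0];\mathbb{R}^n),\mathcal{H})$-local exponential stability. Moreover, if $f$ is globally Lipschitz continuous with respect to the second argument, uniformly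 with respect to the first argument, then (ii) and (iii) still hold when replacing ''local'' by ''global''.
   Context: $\mathbb{R}^n$ carries the Euclidean norm $\Vert\cdot\Vert$. $\mathcal{C}^0([-h_M,0];\mathbb{R}^n)$ is endowed with the uniform norm $\Vert \phi \Vert_\infty = \sup_{s \in [-h_M,0]} \Vert \phi(s) \Vert$. $W$ is the set of absolutely continuous functions $\phi : [-h_M,0] \rightarrow \mathbb{R}^n$ with square integrable weak derivative $\dot\phi$, endowed with the norm $\Vert \phi \Vert_W = \sqrt{\Vert \phi(0) \Vert^2 + \int_{-h_M}^0 \Vert \dot{\phi}(s) \Vert^2 \,\mathrm{d}s}$. For a continuous function $x:[-h_M,t_f)\to\mathbb{R}^n$ with $t_f>0$ and for $0\le t<t_f$, $x_t = x(t+\cdot) \in \mathcal{C}^0([-h_M,0];\mathbb{R}^n)$. The system trajectory is the maximal solution of the equation associated with $x_0$ and $\zeta$. Class $\mathcal{K}$: continuous strictly increasing functions $\alpha:\mathbb{R}_+\to\mathbb{R}_+$ with $\alpha(0)=0$. Class $\mathcal{KL}$: continuous $\beta:\mathbb{R}_+\times\mathbb{R}_+\to\mathbb{R}_+$ such that $s\mapsto\beta(s,t)$ is of class $\mathcal{K}$ for each fixed $t\ge0$, and $t\mapsto\beta(s,t)$ is strictly decreasing with $\lim_{t\to+\infty}\beta(s,t)=0$ for each fixed $s>0$. A set $\mathcal{H} \subset \mathcal{C}^0(\mathbb{R}_+;\mathbb{R}^r)$ is forward invariant if for any $\zeta \in \mathcal{H}$ and any $a > 0$ we have $\zeta(\cdot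 + a) \in \mathcal{H}$. Let $(X,\Vert\cdot\Vert_X)$ be either $(\mathcal{C}^0([-h_M,0];\mathbb{R}^n),\Vert\cdot\Vert_\infty)$ or $(W,\Vert\cdot\Vert_W)$. - The system is $(X,\mathcal{H})$-stable if there exist $\alpha \in \mathcal{K}$ and $R > 0$ such that for any $x_0 \in X$ with $\Vert x_0 \Vert_X < R$ and any $\zeta \in \mathcal{H}$, the system trajectory $x$ is well defined on $\mathbb{R}_+$ with $\Vert x(t) \Vert \leq \alpha(\Vert x_0 \Vert_X)$ for all $t \geq 0$. - It is $(X,\mathcal{H})$-locally uniformly asymptotically stable if there exist $\beta\in\mathcal{KL}$ and $R > 0$ such that for any $x_0 \in X$ with $\Vert x_0 \Vert_X < R$ and any $\zeta \in \mathcal{H}$, the trajectory $x$ (is defined on $\mathbb{R}_+$ and) satisfies $\Vert x(t) \Vert \leq \beta(\Vert x_0 \Vert_X,t)$ for all $t \geq 0$. If one can select $R = +\infty$, it is $(X,\mathcal{H})$-globally uniformly asymptotically stable. - It is $(X,\mathcal{H})$-locally/globally exponentially stable if there exist constants $\kappa , C_0 > 0$ such that it is $(X,\mathcal{H})$-locally/globally uniformly asymptotically stable with $\beta(s,t) = C_0 e^{-\kappa t} s$. *)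

(* Defs.v *)
From HB Require Import structures.
From mathcomp Require Import all_boot all_order all_algebra.
From mathcomp Require Import all_classical all_reals all_analysis.

Set Implicit Arguments.
Unset Strict Implicit.
Unset Printing Implicit Defensive.

Import Order.TTheory GRing.Theory Num.Theory.
Import numFieldNormedType.Exports.

Local Open Scope classical_set_scope.
Local Open Scope ring_scope.

(* The norm of the library on 'rV[R]_n is the max norm; it induces the same
   topology as the Euclidean one. *)
Definition enorm (R : realType) (n : nat) (v : 'rV[R]_n) : R :=
  Num.sqrt (\sum_(i < n) v 0 i ^+ 2).

(* A function on an interval of R (such as [-hM, 0], R_+ or [-hM, tf)) is
   represented by a total function on R; all the notions below only depend on
   its restriction to that interval. *)

Definition C0 (R : realType) (n : nat) (hM : R) : set (R -> 'rV[R]_n) :=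
  [set phi | {within `[- hM, 0], continuous phi}].

Definition supnorm (R : realType) (n : nat) (hM : R) (phi : R -> 'rV[R]_n) : R :=
  sup [set enorm (phi s) | s in `[- hM, 0]].

Definition abs_continuous (R : realType) (n : nat) (hM : R)
    (phi : R -> 'rV[R]_n) : Prop :=
  forall e : R, 0 < e -> exists2 d : R, 0 < d &
    forall (m : nat) (a b : 'I_m -> R),
      (forall i, - hM <= a i /\ a i <= b i /\ b i <= 0) ->
      trivIset setT (fun i => `]a i, b i[%classic) ->
      \sum_(i < m) (b i - a i) < d ->
      \sum_(i < m) enorm (phi (b i) - phi (a i)) < e.

(* C^1 functions with compact support in (-hM, 0). *)
Definition test_function (R : realType) (hM : R) (v : R -> R) : Prop :=
  [/\ forall s : R, derivable v s 1,
      continuous (derive1 v) &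
      exists a b : R, [/\ - hM < a, b < 0 &
        forall s, ~ (a <= s <= b) -> v s = 0]].

Definition is_weak_derivative (R : realType) (n : nat) (hM : R)
    (phi g : R -> 'rV[R]_n) : Prop :=
  forall i : 'I_n,
    locally_integrable `]- hM, 0[ (fun s => g s 0 i) /\
    forall v, test_function hM v ->
      \int[lebesgue_measure]_(s in `]- hM, 0[) (phi s 0 i * derive1 v s) =
      - \int[lebesgue_measure]_(s in `]- hM, 0[) (g s 0 i * v s).

Definition square_integrable (R : realType) (n : nat) (hM : R)
    (g : R -> 'rV[R]_n) : Prop :=
  lebesgue_measure.-integrable `[- hM, 0] (fun s => (enorm (g s) ^+ 2)%:E).

Definition W (R : realType) (n : nat) (hM : R) : set (R -> 'rV[R]_n) :=
  [set phi | abs_continuous hM phi /\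
     exists2 g, is_weak_derivative hM phi g & square_integrable hM g].

(* A representative; weak derivatives are unique almost everywhere. *)
Definition weak_derivative (R : realType) (n : nat) (hM : R)
    (phi : R -> 'rV[R]_n) : R -> 'rV[R]_n :=
  xget (cst 0) [set g | is_weak_derivative hM phi g].

Definition Wnorm (R : realType) (n : nat) (hM : R) (phi : R -> 'rV[R]_n) : R :=
  Num.sqrt (enorm (phi 0) ^+ 2 +
    \int[lebesgue_measure]_(s in `[- hM, 0])
      (enorm (weak_derivative hM phi s) ^+ 2)).

(* The right-hand side f : A x C^0([-hM, 0]; R^n) -> R^n.  The continuity of f
   for the topology of uniform convergence on [-hM, 0] implies that f a phi
   only depends on the restriction of phi to [-hM, 0]. *)
Definition rhs_continuous (R : realType) (r n : nat) (hM : R)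
    (A : set 'rV[R]_r) (f : 'rV[R]_r -> (R -> 'rV[R]_n) -> 'rV[R]_n) : Prop :=
  {within [set p : 'rV[R]_r * {uniform` `[- hM, 0]%classic -> 'rV[R]_n} |
             A p.1 /\ C0 hM p.2],
   continuous (fun p => f p.1 p.2)}.

Definition rhs_locally_lipschitz (R : realType) (r n : nat) (hM : R)
    (A : set 'rV[R]_r) (f : 'rV[R]_r -> (R -> 'rV[R]_n) -> 'rV[R]_n) : Prop :=
  forall a phi, A a -> C0 hM phi ->
  exists d L : R, 0 < d /\
    forall b psi1 psi2, A b -> C0 hM psi1 -> C0 hM psi2 ->
      enorm (b - a) < d ->
      supnorm hM (psi1 \- phi) < d -> supnorm hM (psi2 \- phi) < d ->
      enorm (f b psi1 - f b psi2) <= L * supnorm hM (psi1 \- psi2).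

(* S is the ball {supnorm <= H} in the local statements, everything in the
   global ones. *)
Definition rhs_lipschitz_on (R : realType) (r n : nat) (hM : R)
    (A : set 'rV[R]_r) (S : set (R -> 'rV[R]_n))
    (f : 'rV[R]_r -> (R -> 'rV[R]_n) -> 'rV[R]_n) : Prop :=
  exists L : R, forall a psi1 psi2, A a ->
    C0 hM psi1 -> S psi1 -> C0 hM psi2 -> S psi2 ->
    enorm (f a psi1 - f a psi2) <= L * supnorm hM (psi1 \- psi2).

(* The translate of zeta is only required to agree on R_+ with a member of H. *)
Definition forward_invariant (R : realType) (r : nat)
    (H : set (R -> 'rV[R]_r)) : Prop :=
  forall zeta a, H zeta -> 0 < a ->
    exists2 eta, H eta & forall t : R, 0 <= t -> eta t = zeta (t + a).

Definition history (R : realType) (n : nat) (x : R -> 'rV[R]_n) (t : R) :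
  R -> 'rV[R]_n := fun s => x (t + s).

(* x solves the equation on [0, tf), with a right derivative at t = 0. *)
Definition solution (R : realType) (r n : nat) (hM : R)
    (f : 'rV[R]_r -> (R -> 'rV[R]_n) -> 'rV[R]_n)
    (x0 : R -> 'rV[R]_n) (zeta : R -> 'rV[R]_r)
    (tf : \bar R) (x : R -> 'rV[R]_n) : Prop :=
  [/\ (0 < tf)%E,
      {within [set t | - hM <= t /\ (t%:E < tf)%E], continuous x},
      forall s : R, - hM <= s <= 0 -> x s = x0 s,
      s^-1 *: (x s - x 0) @[s --> 0^'+] --> f (zeta 0) (history x 0) &
      forall t : R, 0 < t -> (t%:E < tf)%E ->
        is_derive t 1 x (f (zeta t) (history x t))].

Definition maximal_solution (R : realType) (r n : nat) (hM : R)
    (f : 'rV[R]_r -> (R -> 'rV[R]_n) -> 'rV[R]_n)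
    (x0 : R -> 'rV[R]_n) (zeta : R -> 'rV[R]_r)
    (tf : \bar R) (x : R -> 'rV[R]_n) : Prop :=
  solution hM f x0 zeta tf x /\
  forall (tf' : \bar R) (y : R -> 'rV[R]_n), solution hM f x0 zeta tf' y ->
    (tf <= tf')%E ->
    (forall t : R, - hM <= t -> (t%:E < tf)%E -> y t = x t) ->
    tf' = tf.

(* The system trajectory is well defined on R_+ and bounded by b there.
   "The" trajectory is expressed by an existence clause together with a clause
   on every maximal solution; maximal solutions are unique on [-hM, tf) when f
   is locally Lipschitz. *)
Definition trajectory_bounded (R : realType) (r n : nat) (hM : R)
    (f : 'rV[R]_r -> (R -> 'rV[R]_n) -> 'rV[R]_n)
    (x0 : R -> 'rV[R]_n) (zeta : R -> 'rV[R]_r) (b : R -> R) : Prop :=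
  (exists x, maximal_solution hM f x0 zeta +oo%E x) /\
  forall tf x, maximal_solution hM f x0 zeta tf x ->
    tf = +oo%E /\ forall t : R, 0 <= t -> enorm (x t) <= b t.

Definition classK (R : realType) (alpha : R -> R) : Prop :=
  [/\ {within `[0, +oo[, continuous alpha},
      forall s s', 0 <= s -> s < s' -> alpha s < alpha s' &
      alpha 0 = 0].

Definition classKL (R : realType) (beta : R -> R -> R) : Prop :=
  [/\ {within [set p : R * R | 0 <= p.1 /\ 0 <= p.2],
        continuous (fun p => beta p.1 p.2)},
      forall t, 0 <= t -> classK (beta ^~ t),
      forall s t t', 0 < s -> 0 <= t -> t < t' -> beta s t' < beta s t &
      forall s, 0 < s -> beta s t @[t --> +oo] --> 0].

(* Below, (X, N) is (C0 hM, supnorm hM) or (W hM, Wnorm hM). *)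

Definition decay_estimate (R : realType) (r n : nat) (hM : R)
    (f : 'rV[R]_r -> (R -> 'rV[R]_n) -> 'rV[R]_n)
    (X : set (R -> 'rV[R]_n)) (N : (R -> 'rV[R]_n) -> R)
    (H : set (R -> 'rV[R]_r)) (beta : R -> R -> R) (rho : \bar R) : Prop :=
  forall x0 zeta, X x0 -> ((N x0)%:E < rho)%E -> H zeta ->
    trajectory_bounded hM f x0 zeta (beta (N x0)).

Definition stable (R : realType) (r n : nat) (hM : R)
    (f : 'rV[R]_r -> (R -> 'rV[R]_n) -> 'rV[R]_n)
    (X : set (R -> 'rV[R]_n)) (N : (R -> 'rV[R]_n) -> R)
    (H : set (R -> 'rV[R]_r)) : Prop :=
  exists (alpha : R -> R) (rho : R), [/\ classK alpha, 0 < rho &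
    decay_estimate hM f X N H (fun s _ => alpha s) rho%:E].

Definition local_UAS (R : realType) (r n : nat) (hM : R)
    (f : 'rV[R]_r -> (R -> 'rV[R]_n) -> 'rV[R]_n)
    (X : set (R -> 'rV[R]_n)) (N : (R -> 'rV[R]_n) -> R)
    (H : set (R -> 'rV[R]_r)) : Prop :=
  exists (beta : R -> R -> R) (rho : R), [/\ classKL beta, 0 < rho &
    decay_estimate hM f X N H beta rho%:E].

Definition global_UAS (R : realType) (r n : nat) (hM : R)
    (f : 'rV[R]_r -> (R -> 'rV[R]_n) -> 'rV[R]_n)
    (X : set (R -> 'rV[R]_n)) (N : (R -> 'rV[R]_n) -> R)
    (H : set (R -> 'rV[R]_r)) : Prop :=
  exists beta : R -> R -> R,
    classKL beta /\ decay_estimate hM f X N H beta +oo%E.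

Definition exp_decay (R : realType) (kappa c : R) : R -> R -> R :=
  fun s t => c * expR (- kappa * t) * s.

Definition local_ES (R : realType) (r n : nat) (hM : R)
    (f : 'rV[R]_r -> (R -> 'rV[R]_n) -> 'rV[R]_n)
    (X : set (R -> 'rV[R]_n)) (N : (R -> 'rV[R]_n) -> R)
    (H : set (R -> 'rV[R]_r)) : Prop :=
  exists kappa c rho : R, [/\ 0 < kappa, 0 < c, 0 < rho &
    decay_estimate hM f X N H (exp_decay kappa c) rho%:E].

Definition global_ES (R : realType) (r n : nat) (hM : R)
    (f : 'rV[R]_r -> (R -> 'rV[R]_n) -> 'rV[R]_n)
    (X : set (R -> 'rV[R]_n)) (N : (R -> 'rV[R]_n) -> R)
    (H : set (R -> 'rV[R]_r)) : Prop :=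
  exists kappa c : R, [/\ 0 < kappa, 0 < c &
    decay_estimate hM f X N H (exp_decay kappa c) +oo%E].

(* Main.v *)
Require Import Defs.
From HB Require Import structures.
From mathcomp Require Import all_boot all_order all_algebra.
From mathcomp Require Import all_classical all_reals all_analysis.
From mathcomp Require Import measurable_realfun lra ring.

Set Implicit Arguments.
Unset Strict Implicit.
Unset Printing Implicit Defensive.

Import Order.TTheory GRing.Theory Num.Theory.
Import numFieldNormedType.Exports.

Local Open Scope classical_set_scope.
Local Open Scope ring_scope.

(** A trajectory issued from a merely continuous initial condition becomes C^1
    after one delay: on [0, hM] it stays of the size of the initial condition,
    and so does its derivative since f(., 0) = 0 and f is Lipschitz.  Hence
    x_hM lies in W with |x_hM|_W <= K |x_0|_oo, and the W estimate can be
    restarted from x_hM with the translated parameter.  Conversely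
    |phi|_oo <= K |phi|_W on W, so a C^0 estimate gives a W estimate. *)

(** * Norms and elementary calculus *)

(** The W hypothesis says nothing about a trajectory before time hM, not even that it exists there.
    Existence on the first delay therefore comes from a Picard iteration, with a bound linear in the
    sup norm of the data. In the local case f is Lipschitz on a ball only: values are truncated to a
    box inside that ball, the iteration then works on any horizon, and small data never meet the
    truncation. The boundedness predicate speaks of every maximal solution, hence the uniqueness
    theorem. The horizon is 2 hM because the restarted solution is glued at hM: the overlap beyond
    hM turns differentiability at the junction into a consequence of uniqueness. On the side of
    function spaces, the W norm uses a representative of the weak derivative selected by choice.
    Nothing can be computed with it until weak derivatives are known to be unique almost everywhere,
    which is obtained by testing with C^1 approximations of indicator functions. *)

Lemma nonexpansive_continuous (R : realType) (V V' : normedModType R) (P : V -> V') :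
  (forall u v, `|P u - P v| <= `|u - v|) -> continuous P.
Proof.
move=> PL u; apply/cvgrPdist_lt => e e0; near=> v.
apply: le_lt_trans (PL u v) _.
by near: v; exact: (@cvgr_dist_lt _ _ _ _ _ _ u (@cvg_id _ (nbhs u))).
Unshelve. all: by end_near. Qed.

Section RowVectorNorms.
Variables (R : realType) (n : nat).
Implicit Types (v : 'rV[R]_n) (c : R).

Lemma norm_coord_le v (i : 'I_n) : `|v 0 i| <= `|v|.
Proof.
rewrite [leRHS]/Num.Def.normr/= mx_normrE.
by apply: le_trans; last exact: (le_bigmax _ _ (ord0, i)).
Qed.

Lemma rV_norm_le v c : 0 <= c -> (forall i, `|v 0 i| <= c) -> `|v| <= c.
Proof.
move=> c0 vc; rewrite [leLHS]/Num.Def.normr/= mx_normrE.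
by apply: bigmax_le => // -[i j] _; rewrite /= ord1.
Qed.

Lemma enorm_ge0 v : 0 <= enorm v.
Proof. exact: sqrtr_ge0. Qed.

Lemma enormN v : enorm (- v) = enorm v.
Proof. by rewrite /enorm; under eq_bigr do rewrite mxE sqrrN. Qed.

Lemma enorm_sqr v : enorm v ^+ 2 = \sum_(i < n) v 0 i ^+ 2.
Proof. by rewrite sqr_sqrtr// sumr_ge0// => i _; rewrite sqr_ge0. Qed.

Lemma norm_coord_le_enorm v (i : 'I_n) : `|v 0 i| <= enorm v.
Proof.
rewrite -sqrtr_sqr ler_wsqrtr// (bigD1 i)//= lerDl.
by rewrite sumr_ge0// => j _; rewrite sqr_ge0.
Qed.

Lemma norm_le_enorm v : `|v| <= enorm v.
Proof. by apply: rV_norm_le (enorm_ge0 _) _ => i; exact: norm_coord_le_enorm. Qed.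

(** The sharp constant is the square root of n; [n.+1] is positive for every n, so later divisions
    by it need no separate case n = 0. *)
Lemma enorm_le_norm v : enorm v <= n.+1%:R * `|v|.
Proof.
rewrite -[leRHS]ger0_norm ?mulr_ge0// -sqrtr_sqr ler_wsqrtr//.
(* The square is spread over n + 1 equal terms, to be compared one by one with the n squared
   coordinates; the last term is dropped. *)
have -> : (n.+1%:R * `|v|) ^+ 2 = \sum_(i < n.+1) (n.+1%:R * `|v| ^+ 2).
  by rewrite sumr_const card_ord exprMn -[RHS]mulr_natl; ring.
rewrite big_ord_recr/= -[leLHS]addr0 lerD ?mulr_ge0 ?sqr_ge0//.
apply: ler_sum => i _; rewrite -real_normK ?num_real//.
apply: (@le_trans _ _ (`|v| ^+ 2)); last by rewrite ler_peMl ?sqr_ge0// ler1n.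
by rewrite ler_pXn2r ?nnegrE// norm_coord_le.
Qed.

Lemma enorm0 : enorm (0 : 'rV[R]_n) = 0.
Proof.
by rewrite /enorm big1 ?sqrtr0// => i _; rewrite mxE expr0n.
Qed.

Lemma cvg_coord {T : Type} {F : set_system T} {FF : Filter F}
    (x : T -> 'rV[R]_n) (i : 'I_n) (l : 'rV[R]_n) :
  x t @[t --> F] --> l -> x t 0 i @[t --> F] --> l 0 i.
Proof. by move=> xl; exact: (cvg_comp _ _ xl (@coord_continuous _ _ _ _ _ _)). Qed.

Lemma continuous_enorm : continuous (@enorm R n).
Proof.
have C : continuous (fun v : 'rV[R]_n => \sum_(i < n) v 0 i ^+ 2).
  apply: continuous_big => [|i _ v]; first exact: add_continuous.
  have vi : {for v, continuous (fun w : 'rV[R]_n => w 0 i)} by exact: coord_continuous.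
  by under eq_fun do rewrite expr2; exact: (cvgM vi vi).
by move=> v; exact: (continuous_comp (C v) (@sqrt_continuous _ _)).
Qed.

End RowVectorNorms.

(** For a <= b, the nearest-point projection onto [a, b]. Precomposing with it extends a function
    continuous on [a, b] to all of R; postcomposing truncates values. *)
Definition clamp (R : realType) (a b t : R) : R := Num.max a (Num.min t b).

Section Clamp.
Variables (R : realType) (a b : R).
Hypothesis ab : a <= b.

Lemma clamp_itv t : a <= clamp a b t <= b.
Proof. by rewrite /clamp le_max lexx/= ge_max ab ge_min lexx orbT. Qed.

Lemma clamp_id t : a <= t <= b -> clamp a b t = t.
Proof. by move=> /andP[at_ tb]; rewrite /clamp min_l// max_r. Qed.

Lemma clamp_lipschitz s t : `|clamp a b s - clamp a b t| <= `|s - t|.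
Proof.
rewrite /clamp; have ab' := ab.
by case: (leP s b) => ?; case: (leP t b) => ?; case: (leP a s) => ?;
  case: (leP a t) => ?; case: (leP a b) => ?; case: (ger0P (s - t)) => ?;
  rewrite ?ler_norml; lra.
Qed.

Lemma continuous_clamp : continuous (clamp a b).
Proof. exact/nonexpansive_continuous/clamp_lipschitz. Qed.

Lemma continuous_comp_clamp (T : topologicalType) (phi : R -> T) :
  {within `[a, b], continuous phi} -> continuous (phi \o clamp a b).
Proof.
move=> /subspace_continuousP phiC t.
have /phiC {}phiC : `[a, b]%classic (clamp a b t) by rewrite /= in_itv/= clamp_itv.
move=> U /phiC; rewrite /within/= => VU.
apply: (@filterS _ (nbhs t) _ _ _ _ (@continuous_clamp t _ VU)) => s /=; apply.
by rewrite in_itv/= clamp_itv.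
Qed.

End Clamp.

Lemma within_itv_bounded (R : realType) (n : nat) (a b : R) (phi : R -> 'rV[R]_n) :
  a <= b -> {within `[a, b], continuous phi} ->
  exists M, forall s, a <= s <= b -> enorm (phi s) <= M.
Proof.
move=> ab phiC; have [] := @EVT_max R (@enorm R n \o phi) a b ab.
  by move=> s; exact: (continuous_comp (phiC s) (@continuous_enorm _ _ _)).
by move=> c _ h; exists (enorm (phi c)) => s sab; apply: h; rewrite in_itv.
Qed.

(** * The uniform norm on [-hM, 0] *)

Section SupNorm.
Variables (R : realType) (n : nat) (hM : R).
Hypothesis hM_ge0 : 0 <= hM.
Implicit Types phi psi : R -> 'rV[R]_n.

Lemma enorm_le_supnorm phi s :
  C0 hM phi -> - hM <= s <= 0 -> enorm (phi s) <= supnorm hM phi.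
Proof.
move=> phiC sI; apply: ub_le_sup; last by exists s => //=; rewrite in_itv.
have [|M hM'] := within_itv_bounded _ phiC; first by rewrite oppr_le0.
by exists M => _ [u /= + <-]; rewrite in_itv => /hM'.
Qed.

Lemma norm_le_supnorm phi s :
  C0 hM phi -> - hM <= s <= 0 -> `|phi s| <= supnorm hM phi.
Proof.
by move=> phiC sI; exact: le_trans (norm_le_enorm _) (enorm_le_supnorm phiC sI).
Qed.

Lemma supnorm_le phi c :
  (forall s, - hM <= s <= 0 -> enorm (phi s) <= c) -> supnorm hM phi <= c.
Proof.
move=> h; apply: ge_sup.
  by exists (enorm (phi 0)); exists 0 => //=; rewrite in_itv/= lexx oppr_le0 hM_ge0.
by move=> _ [s /= + <-]; rewrite in_itv => /h.
Qed.

Lemma supnorm_le_norm phi c :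
  (forall s, - hM <= s <= 0 -> `|phi s| <= c) -> supnorm hM phi <= n.+1%:R * c.
Proof.
move=> h; apply: supnorm_le => s /h phis.
by apply: le_trans (enorm_le_norm _) _; rewrite ler_wpM2l.
Qed.

Lemma supnorm_ge0 phi : C0 hM phi -> 0 <= supnorm hM phi.
Proof.
move=> phiC; apply: le_trans (enorm_ge0 _) (enorm_le_supnorm phiC (s := 0) _).
by rewrite lexx oppr_le0 hM_ge0.
Qed.

Lemma C0B phi psi : C0 hM phi -> C0 hM psi -> C0 hM (phi \- psi).
Proof. by move=> phiC psiC s; apply: cvgB; [exact: phiC|exact: psiC]. Qed.

Lemma continuous_C0 phi : continuous phi -> C0 hM phi.
Proof. by move=> phiC; apply: continuous_subspaceT. Qed.

End SupNorm.

(** * Antiderivatives and the mean value inequality for vector-valued functions *)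

Section Calculus.
Variable R : realType.

(** Integrating from -1 rather than 0 gives a two-sided derivative at 0, from which the right
    derivative of a solution at its initial time will be read off. *)
Lemma continuous_antiderivative (g : R -> R) : continuous g ->
  exists2 G : R -> R, G 0 = 0 & forall t : R, -1 < t -> is_derive t 1 G (g t).
Proof.
move=> gC; pose F x := (\int[lebesgue_measure]_(t in `[(-1 : R), x]) g t)%R.
exists (fun x => F x - F 0) => [|t t1]; first by rewrite subrr.
have [||dF F'] := @continuous_FTC1_closed R g (-1) t (t + 1) _ _ t1 (gC t).
- by rewrite ltrDl.
- apply: continuous_compact_integrable; first exact: segment_compact.
  exact: continuous_subspaceT.
have {}F' : is_derive t 1 F (g t) by apply: DeriveDef; [exact: dF|rewrite -derive1E; exact: F'].
rewrite -[g t]subr0.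
by apply: is_deriveB; exact: is_derive_cst.
Qed.

Lemma is_derive_coord n (x : R -> 'rV[R]_n) (t : R) (v : 'rV[R]_n) (i : 'I_n) :
  is_derive t 1 x v -> is_derive t 1 (fun s => x s 0 i) (v 0 i).
Proof.
move=> [dx xv]; have /derivable_mxP/(_ 0 i) dxi := dx.
by apply: DeriveDef => //; rewrite -xv derive_mx// mxE.
Qed.

Lemma is_derive_row n (x : 'I_n -> R -> R) (t : R) (v : 'I_n -> R) :
  (forall i, is_derive t 1 (x i) (v i)) ->
  is_derive t 1 (fun s => \row_i x i s) (\row_i v i).
Proof.
move=> dx; have xE i j : (fun s => (\row_k x k s) i j) = x j.
  by apply/funext => s; rewrite mxE.
have drow : derivable (fun s => \row_i x i s) t 1.
  by apply/derivable_mxP => i j; rewrite xE; have [] := dx j.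
apply: DeriveDef => //; rewrite derive_mx//; apply/rowP => j.
by rewrite !mxE xE; have [] := dx j.
Qed.

Lemma continuous_antiderivative_row n (g : R -> 'rV[R]_n) : continuous g ->
  exists2 G : R -> 'rV[R]_n, G 0 = 0 & forall t : R, -1 < t -> is_derive t 1 G (g t).
Proof.
move=> gC.
have H i : exists G : R -> R, G 0 = 0 /\ forall t : R, -1 < t -> is_derive t 1 G (g t 0 i).
  have [|G G0 G'] := @continuous_antiderivative (fun t => g t 0 i).
    by move=> t; apply: cvg_coord; exact: gC.
  by exists G.
have [G HG] := choice H.
exists (fun t => \row_i G i t) => [|t t1].
  by apply/rowP => i; rewrite !mxE; have [] := HG i.
have -> : g t = \row_i (g t 0 i) by apply/rowP => i; rewrite mxE.
by apply: is_derive_row => i; apply: (HG i).2.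
Qed.

(** The mean value theorem is applied to B + x_i and B - x_i, whose derivatives are nonnegative.
    Working coordinatewise costs no constant, since the norm is the max norm. *)
Lemma mean_value_ineq n (x : R -> 'rV[R]_n) (g : R -> 'rV[R]_n) (B b : R -> R) (s t : R) :
  s <= t ->
  {within `[s, t], continuous x} -> {within `[s, t], continuous B} ->
  (forall u : R, s < u < t -> is_derive u 1 x (g u)) ->
  (forall u : R, s < u < t -> is_derive u 1 B (b u)) ->
  (forall u : R, s < u < t -> `|g u| <= b u) ->
  `|x t - x s| <= B t - B s.
Proof.
rewrite le_eqVlt => /orP[/eqP ->|st] xC BC dx dB gb; first by rewrite !subrr normr0.
have xiC i : {within `[s, t], continuous (fun u => x u 0 i)}.
  by move=> u; apply: cvg_coord; exact: xC.
have key i : `|x t 0 i - x s 0 i| <= B t - B s.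
  rewrite ler_norml; apply/andP; split.
  - have [||c] := @MVT R (fun u => B u + x u 0 i) (fun u => b u + g u 0 i) s t st.
    + move=> u /[!in_itv]/= sut; apply: is_deriveD; first exact: dB.
      exact: is_derive_coord (dx _ sut).
    + by move=> u; apply: cvgD; [exact: BC|exact: xiC].
    move=> /[!in_itv]/= sct E.
    have : 0 <= (b c + g c 0 i) * (t - s).
      rewrite mulr_ge0// ?subr_ge0 ?(ltW st)//.
      have := le_trans (norm_coord_le (g c) i) (gb _ sct).
      by rewrite ler_norml => /andP[]; lra.
    by rewrite -E; lra.
  - have [||c] := @MVT R (fun u => B u - x u 0 i) (fun u => b u - g u 0 i) s t st.
    + move=> u /[!in_itv]/= sut; apply: is_deriveB; first exact: dB.
      exact: is_derive_coord (dx _ sut).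
    + by move=> u; apply: cvgB; [exact: BC|exact: xiC].
    move=> /[!in_itv]/= sct E.
    have : 0 <= (b c - g c 0 i) * (t - s).
      rewrite mulr_ge0// ?subr_ge0 ?(ltW st)//.
      have := le_trans (norm_coord_le (g c) i) (gb _ sct).
      by rewrite ler_norml => /andP[]; lra.
    by rewrite -E; lra.
apply: rV_norm_le => [|i]; last by rewrite !mxE.
(* For n = 0 no coordinate yields the nonnegativity of B t - B s, so it is proved separately. *)
have dB' u : u \in `]s, t[ -> is_derive u 1 B (b u) by rewrite in_itv; exact: dB.
have [c] := MVT st dB' BC.
move=> /[!in_itv]/= sct ->; rewrite mulr_ge0 ?subr_ge0 ?(ltW st)//.
exact: le_trans (gb _ sct).
Qed.

End Calculus.

(** * Weak derivatives *)

Section SmoothStep.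
Variable R : realType.
Implicit Types (x y e h : R).

(** Suited to splines: the error bound is checked by cases on signs, so one-sided derivatives at the
    knots never appear. *)
Lemma is_derive_quadratic_error (f : R -> R) y (d : R) :
  (forall h, `|f (y + h) - f y - h * d| <= h ^+ 2) -> is_derive y 1 f d.
Proof.
move=> fd.
have cd : h^-1 *: (f (h *: 1 + y) - f y) @[h --> 0^'] --> d.
  apply/cvgrPdist_le => e e0; near=> h.
  have h0 : h != 0 by near: h; exact: nbhs_dnbhs_neq.
  rewrite scaler1 [h + y]addrC distrC.
  have -> : h^-1 *: (f (y + h) - f y) - d = h^-1 * (f (y + h) - f y - h * d).
    by rewrite /GRing.scale/=; field.
  rewrite normrM normfV ler_pdivrMl ?normr_gt0//.
  apply: le_trans (fd h) _; rewrite -real_normK ?num_real// expr2 ler_wpM2l//.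
  by near: h; apply: dnbhs0_le.
by apply: DeriveDef; [apply/cvg_ex; exists d|apply/cvg_lim].
Unshelve. all: by end_near. Qed.

Definition pos_sqr x : R := Num.max 0 x ^+ 2.

Lemma is_derive_pos_sqr y : is_derive y 1 pos_sqr (2 * Num.max 0 y).
Proof.
apply: is_derive_quadratic_error => h; rewrite /pos_sqr ler_norml.
by case: (leP 0 (y + h)) => ?; case: (leP 0 y) => ?; apply/andP; split; nra.
Qed.

(* The quadratic spline with knots 0, 1/2, 1, which is C^1 and rises from 0 to 1. *)
Definition smooth_step x : R :=
  2 * pos_sqr x - 4 * pos_sqr (x - 2^-1) + 2 * pos_sqr (x - 1).

(** The derivative of [smooth_step]: a hat supported in [0, 1] with height 2 and integral 1. *)
Definition tent x : R :=
  4 * Num.max 0 x - 8 * Num.max 0 (x - 2^-1) + 4 * Num.max 0 (x - 1).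

Lemma tent_ge0 x : 0 <= tent x.
Proof.
by rewrite /tent; case: (leP 0 x) => ?; case: (leP 0 (x - 2^-1)) => ?;
  case: (leP 0 (x - 1)) => ?; lra.
Qed.

Lemma tent_eq0 x : ~ (0 <= x <= 1) -> tent x = 0.
Proof.
move=> /negP; rewrite negb_and -!ltNge /tent => /orP[] ?;
  by case: (leP 0 x) => ?; case: (leP 0 (x - 2^-1)) => ?;
  case: (leP 0 (x - 1)) => ?; lra.
Qed.

Lemma smooth_step_le0 x : x <= 0 -> smooth_step x = 0.
Proof.
by move=> ?; rewrite /smooth_step /pos_sqr; case: (leP 0 x) => ?;
  case: (leP 0 (x - 2^-1)) => ?; case: (leP 0 (x - 1)) => ?; nra.
Qed.

Lemma smooth_step_ge1 x : 1 <= x -> smooth_step x = 1.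
Proof.
by move=> ?; rewrite /smooth_step /pos_sqr; case: (leP 0 x) => ?;
  case: (leP 0 (x - 2^-1)) => ?; case: (leP 0 (x - 1)) => ?; nra.
Qed.

Lemma smooth_step_itv x : 0 <= smooth_step x <= 1.
Proof.
by rewrite /smooth_step /pos_sqr; case: (leP 0 x) => ?;
  case: (leP 0 (x - 2^-1)) => ?; case: (leP 0 (x - 1)) => ?;
  apply/andP; split; nra.
Qed.

Lemma continuous_max0 : continuous (fun x : R => Num.max 0 x).
Proof.
apply: nonexpansive_continuous => x y.
by case: (leP 0 x) => ?; case: (leP 0 y) => ?; case: (ger0P (x - y)) => ?;
  rewrite ?ler_norml; lra.
Qed.

Lemma continuous_tent : continuous tent.
Proof.
have C a b : continuous (fun x : R => b * Num.max 0 (x - a)).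
  move=> x; apply: cvgM; first exact: cvg_cst.
  have xa : y - a @[y --> x] --> x - a by apply: cvgB; [exact: cvg_id|exact: cvg_cst].
  exact: (cvg_comp _ _ xa (@continuous_max0 _)).
move=> x; apply: cvgD; last exact: C.
apply: cvgB; last exact: C.
by apply: cvgM; [exact: cvg_cst|exact: continuous_max0].
Qed.

(** For e > 0 the rise from 0 to 1 takes place on [s, s + e], so [ramp'] approximates a Dirac mass
    at s, and a difference of two ramps with s <= t approximates the indicator of ]s, t]. *)
Definition ramp s e x : R := smooth_step (e^-1 * (x - s)).
Definition ramp' s e x : R := e^-1 * tent (e^-1 * (x - s)).

Lemma is_derive_ramp s e x : is_derive x 1 (ramp s e) (ramp' s e x).
Proof.
have D a b : is_derive x 1 (fun x => b * pos_sqr (e^-1 * (x - s) - a))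
    (e^-1 * (2 * b * Num.max 0 (e^-1 * (x - s) - a))).
  have dg : is_derive x 1 (fun x => e^-1 * (x - s) - a) e^-1.
    apply: is_derive_eq; rewrite /GRing.scale/=; ring.
  have := @is_derive1_comp _ pos_sqr _ _ _ _ (is_derive_pos_sqr _) dg.
  move=> dc; apply: is_derive_eq; rewrite /GRing.scale/=; ring.
have := is_deriveD (is_deriveB (D 0 2) (D 2^-1 4)) (D 1 2).
set F := (F in is_derive _ _ F _); set d := (d in is_derive _ _ _ d).
have -> : F = ramp s e.
  apply/funext => y; pose z := e^-1 * (y - s).
  have -> : F y = 2 * pos_sqr (z - 0) - 4 * pos_sqr (z - 2^-1) + 2 * pos_sqr (z - 1) by [].
  by rewrite subr0.
suff -> : d = ramp' s e x by [].
by rewrite /d /ramp' /tent subr0; ring.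
Qed.

Lemma continuous_ramp' s e : continuous (ramp' s e).
Proof.
move=> x; apply: cvgM; first exact: cvg_cst.
have xs : e^-1 * (y - s) @[y --> x] --> e^-1 * (x - s).
  by apply: cvgM; [exact: cvg_cst|apply: cvgB; [exact: cvg_id|exact: cvg_cst]].
exact: (cvg_comp _ _ xs (@continuous_tent _)).
Qed.

Lemma continuous_ramp s e : continuous (ramp s e).
Proof.
move=> x; apply: differentiable_continuous; apply/derivable1_diffP.
by have [] := is_derive_ramp s e x.
Qed.

Section Ramp.
Variables (s e : R).
Hypothesis e0 : 0 < e.

Lemma ramp'_ge0 x : 0 <= ramp' s e x.
Proof. by rewrite mulr_ge0 ?tent_ge0// invr_ge0 ltW. Qed.

Lemma ramp'_eq0 x : ~ (s <= x <= s + e) -> ramp' s e x = 0.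
Proof.
move=> xs; rewrite /ramp' tent_eq0 ?mulr0// => /andP[a b]; apply: xs.
rewrite pmulr_rge0 ?invr_gt0// subr_ge0 in a.
rewrite ler_pdivrMl// mulr1 in b.
by rewrite a/=; lra.
Qed.

Lemma ramp_le x : x <= s -> ramp s e x = 0.
Proof.
by move=> xs; rewrite /ramp smooth_step_le0// pmulr_rle0 ?invr_gt0// subr_le0.
Qed.

Lemma ramp_ge x : s + e <= x -> ramp s e x = 1.
Proof. by move=> xs; rewrite /ramp smooth_step_ge1// ler_pdivlMl// mulr1; lra. Qed.

Lemma ramp_itv x : 0 <= ramp s e x <= 1.
Proof. exact: smooth_step_itv. Qed.

End Ramp.

End SmoothStep.

(** * The fundamental theorem of calculus for weak derivatives *)

Section WeakFTC.
Variables (R : realType) (hM : R).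
Hypothesis hM_gt0 : 0 < hM.
Notation mu := (@lebesgue_measure R).

Lemma continuous_itv_integrable (a b : R) (w : R -> R) :
  {within `[a, b], continuous w} -> mu.-integrable `[a, b] (EFin \o w).
Proof. by move=> wC; apply: continuous_compact_integrable; [exact: segment_compact|]. Qed.

Lemma Rintegral_itv_oo_cc (a b : R) (w : R -> R) :
  mu.-integrable `[a, b] (EFin \o w) ->
  (\int[mu]_(x in `]a, b[) w x = \int[mu]_(x in `[a, b]) w x)%R.
Proof.
move=> wi; rewrite Rintegral_itv_bndo_bndc; last first.
  by apply: integrableS wi => //; exact: subset_itv_oo_cc.
rewrite Rintegral_itv_obnd_cbnd//.
by apply: integrableS wi => //; exact: subset_itv_oc_cc.
Qed.

Lemma derive1_ramp (s t e : R) :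
  derive1 (fun x => ramp s e x - ramp t e x) = fun x => ramp' s e x - ramp' t e x.
Proof.
apply/funext => x; rewrite derive1E.
by have [_ ] := is_deriveB (is_derive_ramp s e x) (is_derive_ramp t e x).
Qed.

Lemma test_function_ramp (s t e : R) : 0 < e -> - hM < s -> s <= t -> t + e < 0 ->
  test_function hM (fun x => ramp s e x - ramp t e x).
Proof.
move=> e0 hs st te; split.
- by move=> x; have [] := is_deriveB (is_derive_ramp s e x) (is_derive_ramp t e x).
- by rewrite derive1_ramp => x; apply: cvgB; exact: continuous_ramp'.
- exists s, (t + e); split=> // x /negP; rewrite negb_and -!ltNge => /orP[] xs.
    by rewrite !ramp_le ?subrr//; lra.
  by rewrite !ramp_ge ?subrr//; lra.
Qed.

Lemma integral_ramp' (s e : R) : 0 < e -> - hM <= s -> s + e <= 0 ->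
  (\int[mu]_(x in `[(- hM), 0]) ramp' s e x = 1)%R.
Proof.
move=> e0 hs se.
rewrite /Rintegral (@continuous_FTC2 _ _ (ramp s e))/=.
- by rewrite ramp_ge// ?ramp_le// ?sub0r; lra.
- by rewrite oppr_lt0.
- by apply: continuous_subspaceT => x; exact: continuous_ramp'.
- split.
  + by move=> x _; have [] := is_derive_ramp s e x.
  + by apply: cvg_at_right_filter; exact: continuous_ramp.
  + by apply: cvg_at_left_filter; exact: continuous_ramp.
- by move=> x _; rewrite derive1E; have [] := is_derive_ramp s e x.
Qed.

(** [ramp'] is a nonnegative kernel of mass 1 carried by [s, s + e], so the integral is an average
    of u there. Both u s and eta are rewritten as integrals against the same kernel. *)
Lemma integral_mul_ramp' (u : R -> R) (s e eta : R) :
  {within `[(- hM), 0], continuous u} -> 0 < e -> - hM <= s -> s + e <= 0 ->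
  (forall x, s <= x <= s + e -> `|u x - u s| <= eta) ->
  `|(\int[mu]_(x in `[(- hM), 0]) (u x * ramp' s e x))%R - u s| <= eta.
Proof.
move=> uC e0 hs se ueta.
have rC : {within `[(- hM), 0], continuous (ramp' s e)}.
  by apply: continuous_subspaceT => x; exact: continuous_ramp'.
have urC : {within `[(- hM), 0], continuous (fun x => u x * ramp' s e x)}.
  by move=> x; apply: cvgM; [exact: uC|exact: rC].
have crC c : {within `[(- hM), 0], continuous (fun x => c * ramp' s e x)}.
  by move=> x; apply: cvgM; [exact: cvg_cst|exact: rC].
have dC : {within `[(- hM), 0], continuous (fun x => u x * ramp' s e x - u s * ramp' s e x)}.
  by move=> x; apply: cvgB; [exact: urC|exact: crC].
have -> : u s = (\int[mu]_(x in `[(- hM), 0]) (u s * ramp' s e x))%R.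
  rewrite RintegralZl ?integral_ramp' ?mulr1//.
  exact: continuous_itv_integrable.
rewrite -RintegralB//; [|exact: continuous_itv_integrable..].
apply: le_trans (le_normr_Rintegral _ _) _ => //.
  exact: continuous_itv_integrable.
have -> : eta = (\int[mu]_(x in `[(- hM), 0]) (eta * ramp' s e x))%R.
  rewrite RintegralZl ?integral_ramp' ?mulr1//.
  exact: continuous_itv_integrable.
apply: le_Rintegral => //.
- by apply: continuous_itv_integrable => x; apply: cvg_norm; exact: dC.
- exact: continuous_itv_integrable.
move=> x _; rewrite -mulrBl normrM (ger0_norm (ramp'_ge0 _ e0 _)).
have [xI|xI] := boolP (s <= x <= s + e).
  by rewrite ler_wpM2r ?ramp'_ge0// ueta.
by rewrite ramp'_eq0 ?mulr0//; exact/negP.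
Qed.

Lemma locally_integrable_itv (g : R -> R) (s t : R) :
  locally_integrable `](- hM), 0[ g -> - hM < s -> t < 0 ->
  mu.-integrable `[s, t] (EFin \o g).
Proof.
move=> [mg _ gK] hs t0.
have st : `[s, t]%classic `<=` `](- hM), 0[%classic.
  by move=> x /=; rewrite !in_itv/= => /andP[? ?]; apply/andP; split; lra.
apply/integrableP; split.
  by apply/measurable_EFinP; exact: measurable_funS mg.
exact: gK st (@segment_compact _ _ _).
Qed.

(** Dominated convergence with dominating function |g|. The limit is the half-open indicator of ]s,
    t], because each ramp still vanishes at its left knot. *)
Lemma integral_mul_ramp_cvg (g : R -> R) (s t d : R) :
  locally_integrable `](- hM), 0[ g -> - hM < s -> s <= t -> 0 < d -> t + d < 0 ->
  (\int[mu]_(x in `](- hM), 0[)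
      (g x * (ramp s (d / k.+1%:R) x - ramp t (d / k.+1%:R) x)))%R @[k --> \oo] -->
  (\int[mu]_(x in `[s, t]) g x)%R.
Proof.
move=> gl hs st d0 td.
pose v k x := ramp s (d / k.+1%:R) x - ramp t (d / k.+1%:R) x : R.
have e0 k : 0 < d / k.+1%:R by rewrite divr_gt0// ltr0n.
have ed k : d / k.+1%:R <= d by rewrite ler_pdivrMr ?ltr0n// ler_peMr ?ler1n// ltW.
have gi : mu.-integrable `[s, t + d] (EFin \o g) by exact: locally_integrable_itv.
have gi' : mu.-integrable `[s, t] (EFin \o g) by apply: locally_integrable_itv => //; lra.
have v0 k x : ~ (s <= x <= t + d) -> v k x = 0.
  rewrite /v; move: (e0 k) (ed k); move: (d / k.+1%:R) => e ? ?.
  move=> /negP; rewrite negb_and -!ltNge => /orP[] xs.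
    by rewrite !ramp_le ?subrr//; lra.
  by rewrite !ramp_ge ?subrr//; lra.
have v1 k x : `|v k x| <= 1.
  have /andP[? ?] := ramp_itv s (d / k.+1%:R) x.
  have /andP[? ?] := ramp_itv t (d / k.+1%:R) x.
  by rewrite /v ler_norml; apply/andP; split; lra.
have vm k : measurable_fun `[s, t + d] (v k).
  apply: measurable_funTS; apply: continuous_measurable_fun => x.
  by apply: cvgB; exact: continuous_ramp.
(* g is integrable on compact subintervals only, so the integral is first confined to [s, t + d],
   which contains all the supports. *)
have gvE k : (\int[mu]_(x in `](- hM), 0[) (g x * v k x) =
    \int[mu]_(x in `[s, (t + d)%R]) (g x * v k x))%R.
  rewrite [LHS]Rintegral_mkcond [RHS]Rintegral_mkcond; congr Rintegral.
  apply/funext => x; rewrite !patchE !mem_setE !in_itv/=.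
  have [xI|xI] := boolP (s <= x <= t + d).
    by rewrite ifT//; move: xI => /andP[? ?]; apply/andP; split; lra.
  by rewrite v0 ?mulr0 ?if_same//; exact/negP.
under eq_fun do rewrite gvE.
have -> : (\int[mu]_(x in `[s, t]) g x =
    \int[mu]_(x in `[s, (t + d)%R]) (g x * (\1_(`]s, t]%classic) x)))%R.
  rewrite -Rintegral_itv_obnd_cbnd; last first.
    by apply: integrableS gi' => //; exact: subset_itv_oc_cc.
  rewrite [LHS]Rintegral_mkcond [RHS]Rintegral_mkcond; congr Rintegral.
  apply/funext => x; rewrite !patchE indicE !mem_setE !in_itv/=.
  have [xI|xI] := boolP (s < x <= t); last by rewrite mulr0 if_same.
  by rewrite ifT ?mulr1//; move: xI => /andP[? ?]; apply/andP; split; lra.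
have cvgE : (\int[mu]_(x in `[s, (t + d)%R]) ((g x * v k x)%:E))%E @[k --> \oo] -->
    (\int[mu]_(x in `[s, (t + d)%R]) ((g x * (\1_(`]s, t]%classic) x))%:E))%E.
  apply: (@dominated_cvg _ _ _ mu _ _ _ _ (fun x => `|(g x)%:E|)%E) => //.
  - move=> k; apply/measurable_EFinP; apply: measurable_funM; last exact: vm.
    by move/integrableP : gi => [/measurable_EFinP].
  - move=> x _.
    apply: cvg_EFin; first exact: nearW.
    apply: cvgM; first exact: cvg_cst.
    (* At each x the values are eventually constant in k: the rising edges shrink towards s and t
       from the right, so x ends up outside them. *)
    apply: cvg_near_cst.
    have near_e r : 0 < r -> \forall k \near \oo, d / k.+1%:R <= r.
      move=> r0; near=> k; rewrite ler_pdivrMr ?ltr0n// mulrC -ler_pdivrMr//.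
      apply: (@le_trans _ _ k%:R); last by rewrite ler_nat.
      by near: k; exact: nbhs_infty_ger.
    rewrite indicE mem_setE in_itv/=.
    have [xs|xs] := leP x s.
      near=> k; rewrite /v !ramp_le// ?subrr//; lra.
    have [xt'|xt'] := leP x t.
      near=> k; rewrite /v ramp_ge// ?(ramp_le (s := t))// ?subr0//.
      by rewrite -lerBrDl; near: k; apply: near_e; rewrite subr_gt0.
    near=> k; rewrite /v !ramp_ge ?subrr// -lerBrDl; near: k; apply: near_e; lra.
  - exact: integrable_abse.
  - by move=> k x _; rewrite /= lee_fin normrM ler_piMr.
have gI : mu.-integrable `[s, t + d] (EFin \o (fun x => g x * (\1_(`]s, t]%classic) x))).
  apply: (le_integrable _ _ _ gi) => //.
    apply/measurable_EFinP; apply: measurable_funM.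
      by move/integrableP : gi => [/measurable_EFinP].
    exact: measurable_indic.
  move=> x _ /=; rewrite lee_fin normrM ler_piMr// indicE.
  by case: (_ \in _); rewrite ?normr1 ?normr0.
have Ifin : (\int[mu]_(x in `[s, (t + d)%R]) (g x * (\1_(`]s, t]%classic) x))%:E)%E
  \is a fin_num by exact: integrable_fin_num.
by move: cvgE; rewrite -[X in _ --> X -> _]fineK//; move/fine_cvg.
Unshelve. all: by end_near. Qed.

(** The weak derivative is tested against [ramp s e - ramp t e] with e tending to 0: one side
    becomes u s - u t, the other minus the integral of g. Test functions are compactly supported in
    the open interval, so s and t stay away from the endpoints. *)
Lemma weak_derivative_FTC (u g : R -> R) (s t : R) :
  {within `[(- hM), 0], continuous u} -> locally_integrable `](- hM), 0[ g ->
  (forall v, test_function hM v ->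
    \int[mu]_(x in `](- hM), 0[) (u x * derive1 v x) =
    - \int[mu]_(x in `](- hM), 0[) (g x * v x)) ->
  - hM < s -> s <= t -> t < 0 ->
  u t - u s = (\int[mu]_(x in `[s, t]) g x)%R.
Proof.
move=> uC gl ug hs st t0.
(* Half the distance from t to 0: ramps of width at most d starting at t end before 0. *)
pose d := - t / 2; have d0 : 0 < d by rewrite /d; lra.
have td : t + d < 0 by rewrite /d; lra.
pose e k : R := d / k.+1%:R.
have e0 k : 0 < e k by rewrite divr_gt0// ltr0n.
have ed k : e k <= d by rewrite ler_pdivrMr ?ltr0n// ler_peMr ?ler1n// ltW.
have urC a k : {within `[(- hM), 0], continuous (fun x => u x * ramp' a (e k) x)}.
  move=> x; apply: cvgM; first exact: uC.
  by apply: continuous_subspaceT => y; exact: continuous_ramp'.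
have cvg_u a : - hM < a -> a + d <= 0 ->
    (\int[mu]_(x in `[(- hM), 0]) (u x * ramp' a (e k) x))%R @[k --> \oo] --> u a.
  move=> ha ad; apply/cvgrPdist_le => eta eta0.
  have aI : `[(- hM), 0]%classic a by rewrite /= in_itv/=; apply/andP; split; lra.
  have /subspace_continuousP/(_ a aI)/cvgrPdist_le/(_ _ eta0) := uC.
  rewrite near_withinE => /nbhs_ballP[r /= r0 hr].
  near=> k; rewrite distrC; apply: integral_mul_ramp' => //.
  - exact: ltW.
  - by apply: le_trans ad; rewrite lerD2l.
  move=> x /andP[ax xa]; rewrite distrC; apply: hr.
    rewrite /ball/= ler0_norm; last by rewrite subr_le0.
    rewrite opprB ltrBlDl; apply: le_lt_trans xa _; rewrite ltrD2l.
    rewrite /e ltr_pdivrMr ?ltr0n// mulrC -ltr_pdivrMr//.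
    apply: (@lt_trans _ _ k%:R); last by rewrite ltr_nat.
    by near: k; exact: nbhs_infty_gtr.
  rewrite /= in_itv/=; apply/andP; split; first by lra.
  by apply: le_trans xa _; apply: le_trans ad; rewrite lerD2l.
have sd : s + d <= 0 by rewrite (le_trans _ (ltW td))// lerD2r.
have cu : (\int[mu]_(x in `[(- hM), 0]) (u x * ramp' s (e k) x) -
    \int[mu]_(x in `[(- hM), 0]) (u x * ramp' t (e k) x))%R @[k --> \oo] --> u s - u t.
  apply: cvgB; first exact: cvg_u.
  by apply: cvg_u (ltW td); exact: lt_le_trans st.
have cg := integral_mul_ramp_cvg gl hs st d0 td.
have E k : (\int[mu]_(x in `[(- hM), 0]) (u x * ramp' s (e k) x) -
    \int[mu]_(x in `[(- hM), 0]) (u x * ramp' t (e k) x) =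
   - \int[mu]_(x in `](- hM), 0[) (g x * (ramp s (e k) x - ramp t (e k) x)))%R.
  rewrite -ug; last first.
    by apply: test_function_ramp => //; apply: le_lt_trans td; rewrite lerD2l.
  rewrite derive1_ramp -RintegralB//; [|exact: continuous_itv_integrable..].
  under [in RHS]eq_Rintegral do rewrite mulrBr.
  rewrite Rintegral_itv_oo_cc//; apply: continuous_itv_integrable => x.
  by apply: cvgB; exact: urC.
have cg' : (- \int[mu]_(x in `](- hM), 0[) (g x * (ramp s (e k) x - ramp t (e k) x)))%R
    @[k --> \oo] --> (- \int[mu]_(x in `[s, t]) g x)%R by exact: cvgN.
move: cg'; under eq_fun do rewrite -E; move=> cg'.
have : (- \int[mu]_(x in `[s, t]) g x)%R = u s - u t by exact: (norm_cvg_unique cg' cu).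
by lra.
Unshelve. all: by end_near. Qed.

End WeakFTC.

(** * Almost everywhere uniqueness of weak derivatives *)

Section WeakUnique.
Variables (R : realType) (hM : R).
Hypothesis hM_gt0 : 0 < hM.
Notation mu := (@lebesgue_measure R).

(** Lebesgue differentiation: the primitive of g1 - g2 from a is identically zero, while its
    derivative is g1 - g2 almost everywhere. *)
Lemma ae_eq_of_integrals (g1 g2 : R -> R) (a b : R) : a < b ->
  mu.-integrable `[a, b] (EFin \o g1) -> mu.-integrable `[a, b] (EFin \o g2) ->
  (forall y, a <= y -> y <= b ->
    (\int[mu]_(x in `[a, y]) g1 x = \int[mu]_(x in `[a, y]) g2 x)%R) ->
  {ae mu, forall x : R, a < x < b -> g1 x = g2 x}.
Proof.
move=> ab g1i g2i g12.
(* Extension by zero makes the difference integrable on the whole line, where the differentiation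
   theorem is applied. *)
pose w := (g1 \- g2) \_ `[a, b].
have gi : mu.-integrable `[a, b] (EFin \o (g1 \- g2)).
  by rewrite (_ : _ \o _ = (EFin \o g1) \- (EFin \o g2))%E//; exact: integrableB.
have wi D : measurable D -> mu.-integrable D (EFin \o w).
  move=> mD; apply: (@integrableS _ _ _ _ setT) => //.
  by rewrite /w -restrict_EFin; apply/integrable_restrict => //; rewrite setTI.
have wl : locally_integrable setT w by exact: integrable_locally.
have H := @FTC1 R w (BLeft a) (fun y => wi _ (measurable_itv _)) wl.
move: H; apply: filterS; first exact: (ae_filter_ringOfSetsType mu).
move=> x /= + /andP[ax xb].
rewrite lte_fin => /(_ ax)[_]; rewrite derive1E.
rewrite (@near_eq_derive _ _ _ _ (cst 0)) ?derive_cst; last first.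
  near=> y.
  have : y \in `]a, b[ by near: y; apply: near_in_itvoo; rewrite in_itv/= ax.
  rewrite in_itv/= => /andP[/ltW ay /ltW yb].
  transitivity (\int[mu]_(t in `[a, y]) (g1 t - g2 t))%R.
    apply: eq_Rintegral => t; rewrite inE/= in_itv/= => /andP[at_ ty].
    by rewrite /w patchE mem_set//= in_itv/= at_/= (le_trans ty).
  have sub : `[a, y]%classic `<=` `[a, b]%classic.
    by move=> t /=; rewrite !in_itv/= => /andP[-> /le_trans ->].
  rewrite RintegralB//; [|exact: integrableS g1i|exact: integrableS g2i].
  by rewrite g12// subrr.
rewrite /w patchE mem_set/=; first by move=> /esym/eqP; rewrite subr_eq0 => /eqP.
by rewrite in_itv/= !ltW.
Unshelve. all: by end_near. Qed.

Lemma ae_eq_of_integrals_oo (g1 g2 : R -> R) :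
  locally_integrable `](- hM), 0[ g1 -> locally_integrable `](- hM), 0[ g2 ->
  (forall s t, - hM < s -> s <= t -> t < 0 ->
    (\int[mu]_(x in `[s, t]) g1 x = \int[mu]_(x in `[s, t]) g2 x)%R) ->
  {ae mu, forall x : R, - hM < x < 0 -> g1 x = g2 x}.
Proof.
move=> g1l g2l g12.
(* The open interval is exhausted by [-hM + e k, - e k], giving a countable union of null sets. The
   shift by 3 keeps 2 * e k below hM already at k = 0. *)
pose e k : R := hM / (k.+3)%:R.
have e0 k : 0 < e k by rewrite divr_gt0// ltr0n.
have eM k : e k + e k < hM.
  rewrite /e -mulrDl ltr_pdivrMr ?ltr0n// -mulr2n -[hM *+ 2]mulr_natr ltr_pM2l//.
  by rewrite ltr_nat.
have H k : {ae mu, forall x : R, - hM + e k < x < - e k -> g1 x = g2 x}.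
  have := e0 k; have := eM k => eMk e0k.
  apply: ae_eq_of_integrals; first by lra.
  - by apply: locally_integrable_itv g1l _ _ => //; lra.
  - by apply: locally_integrable_itv g2l _ _ => //; lra.
  by move=> y ay yb; apply: g12 => //; lra.
move: (ae_foralln H); apply: filterS.
move=> x /= xk /andP[hx x0].
have near_e r : 0 < r -> \forall k \near \oo, e k < r.
  move=> r0; near=> k; rewrite ltr_pdivrMr ?ltr0n// mulrC -ltr_pdivrMr//.
  apply: (@lt_trans _ _ k%:R); last by rewrite ltr_nat ltnS leqW// leqnSn.
  by near: k; exact: nbhs_infty_gtr.
near \oo => k; apply: (xk k).
have e1 : e k < x + hM by near: k; apply: near_e; lra.
have e2 : e k < - x by near: k; apply: near_e; lra.
by apply/andP; split; lra.
Unshelve. all: by end_near. Qed.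

(** Two weak derivatives have the same integral over every interior [s, t], namely the increment of
    phi. *)
Lemma weak_derivative_ae_unique (n : nat) (phi g1 g2 : R -> 'rV[R]_n) :
  C0 hM phi -> is_weak_derivative hM phi g1 -> is_weak_derivative hM phi g2 ->
  {ae mu, forall x : R, - hM < x < 0 -> g1 x = g2 x}.
Proof.
move=> phiC w1 w2.
have H (i : 'I_n) : {ae mu, forall x : R, - hM < x < 0 -> g1 x 0 i = g2 x 0 i}.
  have [l1 e1] := w1 i; have [l2 e2] := w2 i.
  have phiiC : {within `[(- hM), 0], continuous (fun s => phi s 0 i)}.
    by move=> s; apply: cvg_coord; exact: phiC.
  apply: ae_eq_of_integrals_oo => // s t hs st t0.
  rewrite -(weak_derivative_FTC hM_gt0 phiiC l1 e1 hs st t0).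
  by rewrite -(weak_derivative_FTC hM_gt0 phiiC l2 e2 hs st t0).
have : {ae mu, forall x : R, forall i : 'I_n, - hM < x < 0 -> g1 x 0 i = g2 x 0 i}.
  by apply: filter_forall.
apply: filterS; first exact: (ae_filter_ringOfSetsType mu).
by move=> x /= h hx; apply/rowP => i; exact: h.
Qed.

End WeakUnique.

(** * The space W and its norm *)

Section WSpace.
Variables (R : realType) (n : nat) (hM : R).
Hypothesis hM_gt0 : 0 < hM.
Notation mu := (@lebesgue_measure R).
Implicit Types phi g : R -> 'rV[R]_n.

Lemma ae_neq (a : R) : {ae mu, forall x : R, x != a}.
Proof.
exists [set a]; split => //; first exact: lebesgue_measure_set1.
by move=> x /= /negP; rewrite negbK => /eqP.
Qed.

(** Absolute continuity is used with a single interval, whose ends are x and y in increasing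
    order. *)
Lemma W_C0 phi : W hM phi -> C0 hM phi.
Proof.
move=> [ac _]; apply/subspace_continuousP => x; rewrite /= in_itv/= => /andP[hx x0].
apply/cvgrPdist_lt => e e0; have [d d0 H] := ac _ e0.
rewrite near_withinE; near=> y; rewrite /= in_itv/= => /andP[hy y0].
have xy : `|x - y| < d.
  by near: y; exact: (@cvgr_dist_lt _ _ _ _ _ _ x (@cvg_id _ (nbhs x))).
have triv (T : Type) (F : 'I_1 -> set T) : trivIset setT F.
  by move=> i j _ _ _; rewrite !ord1.
apply: le_lt_trans (norm_le_enorm _) _.
have [le_xy|/ltW le_yx] := leP x y.
  have := H 1 (fun=> x) (fun=> y).
  rewrite !big_ord1 distrC ger0_norm ?subr_ge0// in xy *.
  by rewrite -[phi x - phi y]opprB enormN; apply => //.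
have := H 1 (fun=> y) (fun=> x).
rewrite !big_ord1 ger0_norm ?subr_ge0// in xy *.
by apply => //.
Unshelve. all: by end_near. Qed.

Lemma Wnorm_sq_ge0 phi : 0 <= enorm (phi 0) ^+ 2 +
    \int[mu]_(s in `[(- hM), 0]) (enorm (weak_derivative hM phi s) ^+ 2).
Proof.
by rewrite addr_ge0 ?sqr_ge0// Rintegral_ge0// => x _; rewrite sqr_ge0.
Qed.

Lemma measurable_enorm_sq phi g : is_weak_derivative hM phi g ->
  measurable_fun `[(- hM), 0] (fun s => enorm (g s) ^+ 2).
Proof.
move=> gw.
rewrite (_ : (fun s => _) = fun s => \sum_(i < n) g s 0 i ^+ 2); last first.
  by apply/funext => s; exact: enorm_sqr.
apply: measurable_sum => i; apply: measurable_funX.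
have [[mg _ _] _] := gw i.
exact: measurable_fun_itv_cc mg.
Qed.

(** The representative selected by [weak_derivative] carries no integrability by construction.
    Almost everywhere equality with a known g transfers square integrability and lets the norm be
    computed from g. *)
Lemma weak_derivative_spec phi g : C0 hM phi ->
  is_weak_derivative hM phi g -> square_integrable hM g ->
  [/\ is_weak_derivative hM phi (weak_derivative hM phi),
      square_integrable hM (weak_derivative hM phi) &
      Wnorm hM phi = Num.sqrt (enorm (phi 0) ^+ 2 +
        \int[mu]_(s in `[(- hM), 0]) (enorm (g s) ^+ 2))].
Proof.
move=> phiC gw gi; set w := weak_derivative hM phi.
have ww : is_weak_derivative hM phi w by rewrite /w /weak_derivative; case: xgetP => [y -> //|/(_ g)].
have mw := measurable_enorm_sq ww; have mg := measurable_enorm_sq gw.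
have ae : ae_eq mu `[(- hM), 0]%classic (fun s => (enorm (w s) ^+ 2)%:E) (fun s => (enorm (g s) ^+ 2)%:E).
  have H := weak_derivative_ae_unique hM_gt0 phiC ww gw.
  (* Uniqueness holds on the open interval while the norm integrates over the closed one; the two
     endpoints are discarded as null sets. *)
  have H1 := ae_neq (- hM); have H2 := ae_neq 0.
  move: H H1 H2; apply: filterS3; first exact: (ae_filter_ringOfSetsType mu).
  move=> x /= h x1 x2.
  rewrite in_itv/= => /andP[hx x0]; rewrite h//.
  by rewrite !lt_neqAle hx x0 x2 eq_sym x1.
have E : (\int[mu]_(s in `[(- hM)%R, 0%R]) ((enorm (w s) ^+ 2)%:E) =
    \int[mu]_(s in `[(- hM)%R, 0%R]) ((enorm (g s) ^+ 2)%:E))%E.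
  by apply: ge0_ae_eq_integral => // [||x _|x _]; rewrite ?lee_fin ?sqr_ge0//; exact/measurable_EFinP.
split; [exact: ww| |by rewrite /Wnorm -/w; congr (Num.sqrt (_ + fine _))].
apply/integrableP; split; first exact/measurable_EFinP.
move/integrableP : gi => [_].
under eq_integral do rewrite gee0_abs ?lee_fin ?sqr_ge0//.
under [X in _ -> (X < _)%E]eq_integral do rewrite gee0_abs ?lee_fin ?sqr_ge0//.
by rewrite E.
Qed.

(* Pointwise |g| <= (lambda + |g|^2 / lambda) / 2 stands in for Cauchy-Schwarz;
   taking lambda close to the W norm loses only a constant factor. *)
Lemma W_integral_le phi (i : 'I_n) (s t lambda : R) : W hM phi ->
  Wnorm hM phi < lambda -> - hM < s -> s <= t -> t < 0 ->
  `|phi t 0 i - phi s 0 i| <= (hM + 1) / 2 * lambda.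
Proof.
move=> phiW Nl hs st t0; have phiC := W_C0 phiW.
have [_ [g0 g0w g0i]] := phiW; have [ww wi _] := weak_derivative_spec phiC g0w g0i.
set w := weak_derivative hM phi in ww wi.
have N0 : 0 <= Wnorm hM phi by exact: sqrtr_ge0.
(* A strict upper bound of the norm may be divided by even when the norm is zero. *)
have l0 : 0 < lambda by apply: le_lt_trans Nl.
pose S := \int[mu]_(x in `[(- hM), 0]) (enorm (w x) ^+ 2).
have Sl : S <= lambda ^+ 2.
  apply: (@le_trans _ _ (Wnorm hM phi ^+ 2)).
    by rewrite sqr_sqrtr ?Wnorm_sq_ge0// lerDr sqr_ge0.
  by rewrite ler_pXn2r ?nnegrE ?(ltW Nl)// ltW.
have phiiC : {within `[(- hM), 0], continuous (fun s => phi s 0 i)}.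
  by move=> x; apply: cvg_coord; exact: phiC.
have [lw ew] := ww i.
rewrite (weak_derivative_FTC hM_gt0 phiiC lw ew)//.
have wiI := locally_integrable_itv lw hs t0.
apply: le_trans (le_normr_Rintegral _ wiI) _ => //.
(* With S <= lambda^2, this pointwise bound integrates over [-hM, 0] to at most lambda * hM / 2 +
   lambda / 2, which is where (hM + 1) / 2 comes from. *)
pose b x := lambda / 2 + (2 * lambda)^-1 * enorm (w x) ^+ 2.
have ci : mu.-integrable `[(- hM), 0] (EFin \o cst (lambda / 2)).
  by apply: continuous_itv_integrable => x; exact: cvg_cst.
have wi' : mu.-integrable `[(- hM), 0] (EFin \o (fun x => (2 * lambda)^-1 * enorm (w x) ^+ 2)).
  by apply: (integrableZl _ (2 * lambda)^-1 wi).
have bi : mu.-integrable `[(- hM), 0] (EFin \o b).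
  by apply: (integrableD _ ci wi').
have sub : `[s, t]%classic `<=` `[(- hM), 0]%classic.
  by move=> x /=; rewrite !in_itv/= => /andP[? ?]; apply/andP; split; lra.
have sbi : mu.-integrable `[s, t] (EFin \o b) by exact: integrableS bi.
have b0 x : 0 <= b x.
  by apply: addr_ge0; [lra|rewrite mulr_ge0 ?sqr_ge0// invr_ge0; lra].
apply: (@le_trans _ _ (\int[mu]_(x in `[s, t]) b x)%R).
  apply: le_Rintegral => //.
    exact: (integrable_norm wiI).
  move=> x _; apply: le_trans (norm_coord_le_enorm _ _) _; rewrite /b.
  set y := enorm _.
  rewrite -subr_ge0 (_ : _ - _ = (2 * lambda)^-1 * (lambda - y) ^+ 2).
    by rewrite mulr_ge0 ?invr_ge0 ?sqr_ge0//; lra.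
  by field; rewrite gt_eqF.
apply: (@le_trans _ _ (\int[mu]_(x in `[(- hM), 0]) b x)%R).
  rewrite /Rintegral fine_le//; [exact: integrable_fin_num|exact: integrable_fin_num|].
  apply: ge0_subset_integral => //; last by move=> x _; rewrite lee_fin.
  by move/integrableP : bi => [].
have E1 : (\int[mu]_(x in `[(- hM), 0]) cst (lambda / 2) x = lambda / 2 * hM)%R.
  rewrite Rintegral_cst//; congr (_ * _).
  have /(congr1 fine) := lebesgue_measure_itv `[(- hM), 0].
  by rewrite /= lte_fin oppr_lt0 hM_gt0 -EFinD/= sub0r opprK.
have -> : (\int[mu]_(x in `[(- hM), 0]) b x = lambda / 2 * hM + (2 * lambda)^-1 * S)%R.
  by rewrite -E1 /S -RintegralZl// -RintegralD.
have : (2 * lambda)^-1 * S <= lambda / 2.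
  by rewrite ler_pdivrMl ?mulr_gt0//; move: Sl; rewrite expr2; lra.
by lra.
Qed.

End WSpace.

(** * W embeds into C^0, and C^1 functions belong to W *)

Section WEmbeddings.
Variables (R : realType) (n : nat) (hM : R).
Hypothesis hM_gt0 : 0 < hM.
Notation mu := (@lebesgue_measure R).
Implicit Types phi g : R -> 'rV[R]_n.

(** The interior estimate extends to the endpoints by continuity. If it failed by 4 eta, moving 0
    and s into the interior would change the increment by less than 2 eta, a contradiction. *)
Lemma W_coord_le phi (i : 'I_n) (s lambda : R) : W hM phi ->
  Wnorm hM phi < lambda -> - hM <= s <= 0 ->
  `|phi 0 0 i - phi s 0 i| <= (hM + 1) / 2 * lambda.
Proof.
move=> phiW Nl sI; have phiC := W_C0 phiW.
have hM0 : - hM <= 0 by rewrite oppr_le0 ltW.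
pose F t := phi (clamp (- hM) 0 t) 0 i.
have FC : continuous F.
  by move=> t; apply: cvg_coord; apply: (continuous_comp_clamp hM0 phiC).
rewrite leNgt; apply/negP => lt_c.
pose eta := (`|phi 0 0 i - phi s 0 i| - (hM + 1) / 2 * lambda) / 4.
have eta0 : 0 < eta by rewrite /eta divr_gt0// subr_gt0.
have /cvgrPdist_lt/(_ _ eta0)/nbhs_ballP[r0 /= r0_gt0 H0] := FC 0.
have /cvgrPdist_lt/(_ _ eta0)/nbhs_ballP[rs /= rs_gt0 Hs] := FC s.
(* Small enough for both continuity radii, and at most hM / 4 so that [-hM + e, -e] is nonempty. *)
pose e := Num.min (Num.min (r0 / 2) (rs / 2)) (hM / 4).
have e0 : 0 < e by rewrite !lt_min !divr_gt0.
have er0 : e <= r0 / 2 by rewrite !ge_min lexx.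
have ers : e <= rs / 2 by rewrite !ge_min lexx orbT.
have eh : e <= hM / 4 by rewrite !ge_min lexx orbT.
have eI : - hM + e <= - e by lra.
pose s' := clamp (- hM + e) (- e) s.
have /andP[s'1 s'2] := clamp_itv eI s; rewrite -/s' in s'1 s'2.
have ss' : `|s - s'| <= e.
  move: sI => /andP[hs s0]; rewrite /s' /clamp.
  by case: (leP s (- e)) => ?; case: (leP (- hM + e) _) => ?; rewrite ler_norml;
     apply/andP; split; lra.
have k0 : `|F 0 - F (- e)| < eta.
  by apply: H0; rewrite /ball/= sub0r opprK ger0_norm; lra.
have ks : `|F s - F s'| < eta by apply: Hs; rewrite /ball/=; lra.
have hs' : - hM < s' by lra.
have F0 : F 0 = phi 0 0 i by rewrite /F clamp_id// hM0 lexx.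
have Fs : F s = phi s 0 i by rewrite /F clamp_id.
have Fe : F (- e) = phi (- e) 0 i by rewrite /F clamp_id//; apply/andP; split; lra.
have Fs' : F s' = phi s' 0 i by rewrite /F clamp_id//; apply/andP; split; lra.
have e0' : - e < 0 by lra.
have := W_integral_le hM_gt0 i phiW Nl hs' s'2 e0'.
rewrite -Fe -Fs'; move: lt_c; rewrite -F0 -Fs => lt_c key.
have tri : `|F 0 - F s| <= `|F 0 - F (- e)| + `|F (- e) - F s'| + `|F s - F s'|.
  rewrite [`|F s - F s'|]distrC.
  apply: le_trans (ler_distD (F s') _ _) _; rewrite lerD2r; exact: ler_distD.
move: eta0 k0 ks tri key lt_c; rewrite /eta -F0 -Fs.
by lra.
Qed.

Lemma supnorm_le_Wnorm : exists2 K : R, 0 < K &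
  forall phi, W hM phi -> supnorm hM phi <= K * Wnorm hM phi.
Proof.
(* The 1 bounds phi 0 by the W norm; the other term bounds the variation of phi. *)
pose k := 1 + (hM + 1) / 2; have k0 : 0 < k by rewrite /k; have := hM_gt0; lra.
exists (n.+1%:R * k) => [|phi phiW]; first by rewrite mulr_gt0.
have N0 : 0 <= Wnorm hM phi by exact: sqrtr_ge0.
rewrite -mulrA; apply: (supnorm_le_norm (ltW hM_gt0)) => s sI.
apply: rV_norm_le => [|i]; first by rewrite mulr_ge0// ltW.
have phi0 : `|phi 0 0 i| <= Wnorm hM phi.
  apply: le_trans (norm_coord_le_enorm _ _) _.
  rewrite /Wnorm -[leLHS]ger0_norm ?enorm_ge0// -sqrtr_sqr ler_wsqrtr// lerDl.
  by rewrite Rintegral_ge0// => x _; rewrite sqr_ge0.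
rewrite leNgt; apply/negP => lt_s.
(* The variation bound needs lambda strictly above the norm. With this d, replacing the norm by the
   norm plus d costs only half of the assumed excess. *)
pose d := (`|phi s 0 i| - k * Wnorm hM phi) / ((hM + 1)).
have d0 : 0 < d by rewrite divr_gt0 ?subr_gt0// addr_gt0.
have lt_N : Wnorm hM phi < Wnorm hM phi + d by rewrite ltrDl.
have := W_coord_le i phiW lt_N sI; rewrite distrC => le_s.
have tri : `|phi s 0 i| <= `|phi s 0 i - phi 0 0 i| + `|phi 0 0 i|.
  by rewrite -{1}[phi s 0 i](subrK (phi 0 0 i)) ler_normD.
have dE : (hM + 1) * d = `|phi s 0 i| - k * Wnorm hM phi.
  by rewrite /d mulrC divfK// gt_eqF// addr_gt0.
have key : (hM + 1) / 2 * (Wnorm hM phi + d) =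
    (hM + 1) / 2 * Wnorm hM phi + (`|phi s 0 i| - k * Wnorm hM phi) / 2.
  by rewrite -dE; field.
move: lt_s le_s; rewrite key /k; lra.
Qed.

Lemma C1_weak_derivative phi g : continuous phi -> continuous g ->
  (forall s : R, - hM < s < 0 -> is_derive s 1 phi (g s)) ->
  is_weak_derivative hM phi g.
Proof.
move=> phiC gC dphi i.
have gic : mu.-integrable `[(- hM), 0] (EFin \o (fun s => g s 0 i)).
  apply: continuous_itv_integrable; apply: continuous_subspaceT => x.
  by apply: cvg_coord; exact: gC.
have gi : mu.-integrable `](- hM), 0[ (EFin \o (fun s => g s 0 i)).
  by apply: integrableS gic => //; exact: subset_itv_oo_cc.
split; first by apply: open_integrable_locally => //; exact: interval_open.
move=> v [dv v'C [a [b [ha b0 v0]]]].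
have giC : continuous (fun s => g s 0 i) by move=> x; apply: cvg_coord; exact: gC.
have piC : continuous (fun s => phi s 0 i) by move=> x; apply: cvg_coord; exact: phiC.
have vC : continuous v.
  by move=> x; apply: differentiable_continuous; apply/derivable1_diffP; exact: dv.
have mC (w1 w2 : R -> R) : continuous w1 -> continuous w2 ->
    mu.-integrable `[(- hM), 0] (EFin \o (fun x => w1 x * w2 x)).
  move=> c1 c2; apply: continuous_itv_integrable; apply: continuous_subspaceT => x.
  by apply: cvgM; [exact: c1|exact: c2].
rewrite !Rintegral_itv_oo_cc; [|exact: mC..].
rewrite (@Rintegration_by_parts R (fun s => phi s 0 i) v (fun s => g s 0 i) (derive1 v)).
(* The boundary terms vanish: -hM and 0 lie outside the support [a, b] of v. *)
- rewrite !v0 ?mulr0 ?subrr ?sub0r//; apply/negP; rewrite negb_and -!ltNge.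
  + by rewrite ha.
  + by rewrite b0 orbT.
- by rewrite oppr_lt0.
- exact: continuous_subspaceT.
- split.
  + move=> x; rewrite in_itv/= => xI.
    by have [] := is_derive_coord i (dphi _ xI).
  + by apply: cvg_at_right_filter; exact: piC.
  + by apply: cvg_at_left_filter; exact: piC.
- move=> x; rewrite in_itv/= => xI; rewrite derive1E.
  by have [] := is_derive_coord i (dphi _ xI).
- exact: continuous_subspaceT.
- split; first by move=> x _; exact: dv.
  + by apply: cvg_at_right_filter; exact: vC.
  + by apply: cvg_at_left_filter; exact: vC.
- by [].
Qed.

Lemma C1_abs_continuous phi g (B : R) : continuous phi ->
  (forall s : R, - hM < s < 0 -> is_derive s 1 phi (g s)) ->
  (forall s, - hM < s < 0 -> `|g s| <= B) ->
  abs_continuous hM phi.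
Proof.
move=> phiC dphi gB e e0.
have B0 : 0 <= B.
  by apply: le_trans (gB (- hM / 2) _); rewrite //; have := hM_gt0 => ?; apply/andP; split; lra.
(* The Lipschitz constant is enlarged to B + 1 so that e / c makes sense when B = 0. *)
pose c := n.+1%:R * (B + 1); have c0 : 0 < c by rewrite mulr_gt0 ?ltr0n//; lra.
exists (e / c); first by rewrite divr_gt0.
move=> m a b abI _; rewrite ltr_pdivlMr// mulr_suml => lt_e.
apply: le_lt_trans lt_e; apply: ler_sum => j _; have [haj [abj bj0]] := abI j.
apply: le_trans (enorm_le_norm _) _.
have : `|phi (b j) - phi (a j)| <= (B + 1) * b j - (B + 1) * a j.
  apply: (@mean_value_ineq R n phi g (fun s => (B + 1) * s) (fun=> B + 1)) => //.
  - exact: continuous_subspaceT.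
  - by apply: continuous_subspaceT => x; apply: cvgM; [exact: cvg_cst|exact: cvg_id].
  - by move=> u /andP[? ?]; apply: dphi; apply/andP; split; lra.
  - move=> u _; apply: is_derive_eq; rewrite /GRing.scale/=; ring.
  - move=> u /andP[? ?]; apply: (@le_trans _ _ B); last by lra.
    by apply: gB; apply/andP; split; lra.
move=> h; apply: (@le_trans _ _ (n.+1%:R * ((B + 1) * b j - (B + 1) * a j))).
  by rewrite ler_wpM2l.
by rewrite /c le_eqVlt; apply/orP; left; apply/eqP; ring.
Qed.

(** This quantifies the gain of regularity after one delay. The factor 1 + hM stands in for the
    square root of hM, which it dominates. *)
Lemma C1_W phi g (B : R) : continuous phi -> continuous g ->
  (forall s : R, - hM < s < 0 -> is_derive s 1 phi (g s)) ->
  (forall s, - hM <= s <= 0 -> `|g s| <= B) ->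
  W hM phi /\ Wnorm hM phi <= n.+1%:R * (`|phi 0| + (1 + hM) * B).
Proof.
move=> phiC gC dphi gB.
have gw := C1_weak_derivative phiC gC dphi.
have B0 : 0 <= B.
  by apply: le_trans (gB 0 _); rewrite ?lexx ?oppr_le0 ?(ltW hM_gt0).
have eC : continuous (fun s => enorm (g s) ^+ 2).
  have C : continuous (fun s => enorm (g s)).
    by move=> x; exact: (continuous_comp (gC x) (@continuous_enorm _ _ _)).
  rewrite (_ : (fun s => _) = fun s => enorm (g s) * enorm (g s)).
    by move=> x; exact: (cvgM (C x) (C x)).
  by apply/funext => s; rewrite expr2.
have gi : square_integrable hM g.
  by apply: continuous_itv_integrable; exact: continuous_subspaceT.
split.
  split; last by exists g.
  by apply: (C1_abs_continuous phiC dphi) => s /andP[? ?]; apply: gB; rewrite !ltW.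
have [_ _ ->] := weak_derivative_spec hM_gt0 (continuous_C0 phiC) gw gi.
have r0 : 0 <= n.+1%:R * (`|phi 0| + (1 + hM) * B).
  by rewrite mulr_ge0// addr_ge0// mulr_ge0//; have := hM_gt0; lra.
rewrite -[leRHS]ger0_norm// -sqrtr_sqr ler_wsqrtr//.
have Ile : (\int[mu]_(s in `[(- hM), 0]) (enorm (g s) ^+ 2) <= (n.+1%:R * B) ^+ 2 * hM)%R.
  apply: (@le_trans _ _ (\int[mu]_(s in `[(- hM), 0]) cst ((n.+1%:R * B) ^+ 2) s)%R).
    apply: le_Rintegral => //.
      by apply: continuous_itv_integrable => x; exact: cvg_cst.
    move=> x /=; rewrite in_itv/= => xI; rewrite ler_pXn2r ?nnegrE ?enorm_ge0//; last by rewrite mulr_ge0.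
    by apply: le_trans (enorm_le_norm _) _; rewrite ler_wpM2l// gB.
  rewrite Rintegral_cst// le_eqVlt; apply/orP; left; apply/eqP; congr (_ * _).
  have /(congr1 fine) := lebesgue_measure_itv `[(- hM), 0].
  by rewrite /= lte_fin oppr_lt0 hM_gt0 -EFinD/= sub0r opprK.
have e0 : enorm (phi 0) ^+ 2 <= (n.+1%:R * `|phi 0|) ^+ 2.
  by rewrite ler_pXn2r ?nnegrE ?enorm_ge0 ?mulr_ge0// enorm_le_norm.
apply: le_trans (lerD e0 Ile) _.
have N0 : 0 <= `|phi 0| by [].
have -> : (n.+1%:R * `|phi 0|) ^+ 2 + (n.+1%:R * B) ^+ 2 * hM =
    n.+1%:R ^+ 2 * (`|phi 0| ^+ 2 + B ^+ 2 * hM) :> R by ring.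
rewrite [leRHS]exprMn ler_wpM2l ?sqr_ge0//.
have := hM_gt0 => h0; have hB : 0 <= hM * B by rewrite mulr_ge0// ltW.
by nra.
Qed.

End WEmbeddings.

(** * Picard iteration *)

Section UniformLimit.
Variables (R : realType) (n : nat).

Lemma half_pow_lt (e : R) : 0 < e -> \forall k \near \oo, 2^-1 ^+ k < e.
Proof.
move=> e0; have H : (fun k => (2^-1 : R) ^+ k) @ \oo --> 0.
  by apply: cvg_expr; rewrite ger0_norm; lra.
near=> k; rewrite -[ltLHS]subr0 -[ltLHS]ger0_norm ?subr0 ?exprn_ge0//.
by rewrite -normrN -sub0r; near: k; exact: cvgr_dist_lt.
Unshelve. all: by end_near. Qed.

(** The increments sum to E * (2^-k - 2^-(k+j)), uniformly in t, so the pointwise limits inherit the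
    rate. *)
Lemma geometric_cauchy (X : nat -> R -> 'rV[R]_n) (E : R) : 0 <= E ->
  (forall k t, `|X k.+1 t - X k t| <= E / 2 * 2^-1 ^+ k) ->
  exists y : R -> 'rV[R]_n, forall k t, `|X k t - y t| <= E * 2^-1 ^+ k.
Proof.
move=> E0 dX.
have tele k j t : `|X (k + j)%N t - X k t| <= E * (2^-1 ^+ k - 2^-1 ^+ (k + j)).
  elim: j => [|j IH]; first by rewrite addn0 !subrr normr0 mulr0.
  rewrite addnS; apply: le_trans (ler_distD (X (k + j)%N t) _ _) _.
  apply: le_trans (lerD (dX _ _) IH) _; rewrite [2^-1 ^+ (k + j).+1]exprS.
  by rewrite le_eqVlt; apply/orP; left; apply/eqP; field.
have tele' k j t : `|X (k + j)%N t - X k t| <= E * 2^-1 ^+ k.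
  apply: le_trans (tele k j t) _; rewrite ler_wpM2l// lerBlDr lerDl exprn_ge0//.
have cX t : cvg (X k t @[k --> \oo]).
  apply: cauchy_cvg; apply: cauchy_exP => e e0.
  have e1 : 0 < e / (E + 1) by rewrite divr_gt0//; lra.
  have [k _ Hk] := half_pow_lt e1.
  exists (X k t); exists k => // j /= kj.
  rewrite -ball_normE/= distrC -(subnKC kj); apply: le_lt_trans (tele' _ _ _) _.
  have := Hk k (leqnn k); rewrite /= ltr_pdivlMr; last by lra.
  have : 0 < (2^-1 : R) ^+ k by rewrite exprn_gt0.
  nra.
exists (fun t => lim (X k t @[k --> \oo])) => k t.
apply/ler_addgt0Pr => e e0.
have /cvgrPdist_le/(_ _ e0)[N _ HN] := cX t.
have := HN (k + N)%N (leq_addl _ _); rewrite /= distrC => h.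
apply: le_trans (ler_distD (X (k + N)%N t) _ _) _; rewrite lerD//.
by rewrite distrC.
Qed.

Lemma continuous_uniform_limit (X : nat -> R -> 'rV[R]_n) (y : R -> 'rV[R]_n) (E : R) :
  (forall k, continuous (X k)) ->
  (forall k t, `|X k t - y t| <= E * 2^-1 ^+ k) -> continuous y.
Proof.
move=> XC Xy t; apply/cvgrPdist_lt => e e0.
have E0 : 0 <= E by have := Xy 0 0; rewrite expr0 mulr1; exact: le_trans.
have e1 : 0 < e / 3 / (E + 1) by rewrite !divr_gt0//; lra.
have [k _ Hk] := half_pow_lt e1.
have Ek : E * 2^-1 ^+ k < e / 3.
  have := Hk k (leqnn k); rewrite /= ltr_pdivlMr; last by lra.
  have : 0 < (2^-1 : R) ^+ k by rewrite exprn_gt0.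
  nra.
near=> s.
have Xs : `|X k t - X k s| < e / 3.
  by near: s; apply: cvgr_dist_lt; [exact: XC|rewrite divr_gt0].
have := Xy k t; have := Xy k s; rewrite [X in _ -> X <= _ -> _]distrC => h1 h2.
apply: le_lt_trans (ler_distD (X k t) _ _) _.
apply: le_lt_trans (lerD h2 (ler_distD (X k s) _ _)) _.
lra.
Unshelve. all: by end_near. Qed.

End UniformLimit.

(** * Fixed points for causal Lipschitz right-hand sides *)

Section Picard.
Variables (R : realType) (n : nat) (L : R) (Phi : (R -> 'rV[R]_n) -> R -> 'rV[R]_n).
Hypothesis L_gt0 : 0 < L.
Hypothesis PhiC : forall x : R -> 'rV[R]_n, continuous x -> continuous (Phi x).
Hypothesis PhiL : forall (x y : R -> 'rV[R]_n) (M t : R), continuous x -> continuous y -> 0 <= t ->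
  (forall s, s <= t -> `|x s - y s| <= M) -> `|Phi x t - Phi y t| <= L * M.
Hypothesis Phi0 : forall t, 0 <= t -> Phi (cst 0) t = 0.

(** The exponential weight of Bielecki: [Phi] costs a factor L and integrating exp (2 L t) gains 1 /
    (2 L), so a Picard step contracts by 1/2 on [0, T] whatever T is, and no continuation over short
    intervals is needed. *)
Let wt (c t : R) := c * expR (2 * L * t).

Let continuous_wt c : continuous (wt c).
Proof.
move=> t; have lC : {for t, continuous (fun s : R => 2 * L * s)}.
  by apply: cvgM; [exact: cvg_cst|exact: cvg_id].
apply: cvgM; first exact: cvg_cst.
exact: (continuous_comp lC (@continuous_expR _ _)).
Qed.

Let is_derive_wt c (u : R) : is_derive u 1 (wt c) (c * (expR (2 * L * u) * (2 * L))).
Proof.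
have dl : is_derive u 1 (fun s : R => 2 * L * s) (2 * L).
  by apply: is_derive_eq; rewrite /GRing.scale/=; ring.
have de := is_derive1_comp (is_derive_expR _) dl.
apply: is_derive_eq; rewrite /GRing.scale/=; ring.
Qed.

Let wt_mono c s t : 0 <= c -> s <= t -> wt c s <= wt c t.
Proof. by move=> c0 st; rewrite ler_wpM2l// ler_expR ler_wpM2l// mulr_ge0// ltW. Qed.

Let weighted_mvt (G g : R -> 'rV[R]_n) (c t : R) : 0 <= t ->
  (forall u : R, -1 < u -> is_derive u 1 G (g u)) ->
  (forall u, 0 < u < t -> `|g u| <= L * wt c u) ->
  `|G t - G 0| <= c / 2 * (expR (2 * L * t) - 1).
Proof.
move=> t0 dG gc.
have -> : c / 2 * (expR (2 * L * t) - 1) = wt (c / 2) t - wt (c / 2) 0.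
  by rewrite /wt mulr0 expR0; ring.
apply: (mean_value_ineq (g := g) (b := fun u => L * wt c u)) => //.
- apply: derivable_within_continuous => u; rewrite in_itv/= => /andP[u0 _].
  by have [] : is_derive u 1 G (g u) by apply: dG; lra.
- exact: continuous_subspaceT.
- by move=> u /andP[u0 _]; apply: dG; lra.
- move=> u _; have := is_derive_wt (c / 2) u; set d := (d in is_derive _ _ _ d).
  by have -> : d = L * wt c u by rewrite /d /wt; field.
Qed.

(** The bound is linear in m because [Phi] vanishes at the zero function; this linearity is what
    preserves exponential estimates. G is returned as well because, unlike y, it is differentiable
    from both sides at 0 and at T. *)
Lemma picard (x0 : R -> 'rV[R]_n) (T m : R) : 0 <= T -> continuous x0 ->
  (forall t, `|x0 t| <= m) ->
  exists y G : R -> 'rV[R]_n, [/\ continuous y, (forall t, t <= 0 -> y t = x0 t),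
    (forall t, `|y t| <= 2 * m * expR (2 * L * T)),
    (forall t : R, -1 < t -> is_derive t 1 G (Phi y t)) &
    forall t, 0 <= t <= T -> y t = x0 0 + G t].
Proof.
move=> T0 x0C x0m; have m0 : 0 <= m := le_trans (normr_ge0 _) (x0m 0).
(* An antiderivative operator obtained by choice; at discontinuous x its value is arbitrary. *)
have [anti antiP] : {anti : (R -> 'rV[R]_n) -> R -> 'rV[R]_n | forall x, continuous x ->
    anti x 0 = 0 /\ forall t : R, -1 < t -> is_derive t 1 (anti x) (Phi x t)}.
  apply: cid; suff /choice[a aP] : forall x : R -> 'rV[R]_n, exists G : R -> 'rV[R]_n,
      continuous x -> G 0 = 0 /\ forall t : R, -1 < t -> is_derive t 1 G (Phi x t).
    by exists a.
  move=> x; have [xC|nxC] := pselect (continuous x); last by exists x.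
  by have [G G0 dG] := continuous_antiderivative_row (PhiC xC); exists G.
(* Freezing time outside [0, T] makes the iterates functions on all of R with bounds uniform in
   t. *)
pose tau := clamp 0 T.
have tauI t : 0 <= tau t <= T by exact: clamp_itv.
pose ini t := x0 (Num.min t 0).
pose step x t := ini t + anti x (tau t).
have iniC : continuous ini.
  pose f (t : R) := - Num.max 0 (- t).
  have fC : continuous f.
    move=> t; apply: cvgN.
    have oC : {for t, continuous (fun s : R => - s)} by apply: cvgN; exact: cvg_id.
    exact: (continuous_comp oC (@continuous_max0 _ _)).
  have -> : ini = x0 \o f.
    apply/funext => t; rewrite /ini /f/=; congr x0.
    by case: (leP t 0) => ?; case: (leP 0 (- t)) => ?; lra.
  by move=> t; exact: (continuous_comp (fC t) (x0C _)).
have stepC x : continuous x -> continuous (step x).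
  move=> /antiP[_ dG] t; apply: cvgD; first exact: iniC.
  have aC : {for tau t, continuous (anti x)}.
    apply: differentiable_continuous; apply/derivable1_diffP.
    have /andP[t0 _] := tauI t.
    by have [] : is_derive (tau t) 1 (anti x) (Phi x (tau t)) by apply: dG; lra.
  exact: (continuous_comp (@continuous_clamp _ _ _ T0 t) aC).
have tau_le u s : 0 <= u -> s <= u -> tau s <= u.
  by move=> u0 su; rewrite /tau /clamp ge_max u0 ge_min su.
have step_contract x y c : continuous x -> continuous y -> 0 <= c ->
    (forall s, `|x s - y s| <= wt c (tau s)) ->
    forall t, `|step x t - step y t| <= wt (c / 2) (tau t).
  move=> xC yC c0 xy t; have [ax0 dax] := antiP _ xC; have [ay0 day] := antiP _ yC.
  have -> : step x t - step y t = (anti x (tau t) - anti y (tau t)) - (anti x 0 - anti y 0).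
    by rewrite ax0 ay0 subrr subr0 /step opprD addrACA subrr add0r.
  apply: (@le_trans _ _ (c / 2 * (expR (2 * L * tau t) - 1))).
    have /andP[t0 tT] := tauI t.
    apply: (weighted_mvt (G := fun s => anti x s - anti y s) (g := fun s => Phi x s - Phi y s)) => //.
      by move=> u u1; apply: is_deriveB; [exact: dax|exact: day].
    move=> u /andP[u0 ut]; apply: PhiL => //; first exact: ltW.
    by move=> s su; apply: le_trans (xy s) _; apply: wt_mono => //; apply: tau_le => //; exact: ltW.
  by rewrite /wt ler_wpM2l//; lra.
have anti_bound x c : continuous x -> 0 <= c -> (forall s, `|x s| <= wt c (tau s)) ->
    forall t, `|anti x (tau t)| <= c / 2 * (expR (2 * L * tau t) - 1).
  move=> xC c0 xm t; have [ax0 dax] := antiP _ xC; have /andP[t0 tT] := tauI t.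
  rewrite -[anti x _]subr0 -[X in _ - X]ax0; apply: (weighted_mvt (g := Phi x)) => // u /andP[u0 ut].
  rewrite -[Phi x u]subr0 -(Phi0 (ltW u0)); apply: PhiL => //; first by move=> ?; exact: cvg_cst.
    exact: ltW.
  move=> s su; rewrite subr0; apply: le_trans (xm s) _.
  by apply: wt_mono => //; apply: tau_le => //; exact: ltW.
have e1 t : 1 <= expR (2 * L * tau t).
  by have /andP[t0 _] := tauI t; rewrite -expR0 ler_expR mulr_ge0// mulr_ge0// ltW.
have step_bound x : continuous x -> (forall s, `|x s| <= wt (2 * m) (tau s)) ->
    forall t, `|step x t| <= wt (2 * m) (tau t).
  move=> xC xm t; have m2 : 0 <= 2 * m by lra.
  have h := anti_bound x (2 * m) xC m2 xm t.
  apply: le_trans (ler_normD _ _) _; apply: le_trans (lerD (x0m _) h) _.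
  by rewrite /wt; have := e1 t; nra.
pose X k := iter k step ini.
have XC k : continuous (X k) by elim: k => [|k IH] //=; exact: stepC.
(* The weighted ball of radius 2 m is stable under [step]: the initial part takes m, the
   antiderivative at most m * (exp (2 L tau) - 1). *)
have Xm k t : `|X k t| <= wt (2 * m) (tau t).
  elim: k t => [|k IH] t; last exact: step_bound.
  by apply: le_trans (x0m _) _; rewrite /wt; have := e1 t; nra.
have expT t : expR (2 * L * tau t) <= expR (2 * L * T).
  by have /andP[_ tT] := tauI t; rewrite ler_expR ler_wpM2l// mulr_ge0// ltW.
pose E := 2 * m * expR (2 * L * T).
have ET : 0 <= expR (2 * L * T) by rewrite expR_ge0.
have E0 : 0 <= E by rewrite /E mulr_ge0// mulr_ge0.
have dX k t : `|X k.+1 t - X k t| <= wt (m * 2^-1 ^+ k) (tau t).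
  elim: k t => [|k IH] t.
    have inim s : `|ini s| <= wt m (tau s).
      by apply: le_trans (x0m _) _; rewrite /wt ler_peMr.
    rewrite expr0 mulr1 /= /step [ini t + _]addrC addrK.
    apply: le_trans (anti_bound _ _ iniC m0 inim t) _.
    by rewrite /wt; have := e1 t; nra.
  rewrite exprS (_ : m * (2^-1 * 2^-1 ^+ k) = m * 2^-1 ^+ k / 2); last by ring.
  by apply: step_contract; [exact: (XC k.+1)|exact: XC|rewrite mulr_ge0// exprn_ge0|].
have [k t|y Xy] := @geometric_cauchy R n X E E0.
  apply: le_trans (dX k t) _; rewrite /wt /E.
  have -> : 2 * m * expR (2 * L * T) / 2 * 2^-1 ^+ k = m * 2^-1 ^+ k * expR (2 * L * T) by field.
  by rewrite ler_wpM2l// mulr_ge0// exprn_ge0.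
have yC := continuous_uniform_limit XC Xy.
have small c : (forall k, `|c| <= 2 * E * expR (2 * L * T) * 2^-1 ^+ k) -> c = 0 :> 'rV[R]_n.
  move=> ck; apply/eqP; rewrite -normr_le0; apply/ler_addgt0Pr => e e0; rewrite add0r.
  pose C := 2 * E * expR (2 * L * T); have C0 : 0 <= C by rewrite !mulr_ge0.
  have e2 : 0 < e / (C + 1) by rewrite divr_gt0//; lra.
  have [k _ Hk] := half_pow_lt e2.
  apply: le_trans (ck k) _; rewrite -/C.
  have := Hk k (leqnn k); rewrite /= ltr_pdivlMr; last by lra.
  have : 0 < (2^-1 : R) ^+ k by rewrite exprn_gt0.
  nra.
(* The defect is at most |y - X_(k+1)| plus |step X_k - step y|, and both terms are of order
   2^-k. *)
have yE t : y t = step y t.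
  apply/eqP; rewrite -subr_eq0; apply/eqP; apply: small => k.
  have h1 := Xy k.+1 t.
  have h2 : `|step (X k) t - step y t| <= wt (E * 2^-1 ^+ k / 2) (tau t).
    apply: step_contract; [exact: XC|exact: yC|by rewrite mulr_ge0// exprn_ge0|].
    move=> s; apply: le_trans (Xy k s) _; rewrite /wt ler_peMr// mulr_ge0// exprn_ge0//.
  rewrite distrC in h1.
  apply: le_trans (ler_distD (X k.+1 t) _ _) _; apply: le_trans (lerD h1 h2) _.
  rewrite /wt exprS; set p := 2^-1 ^+ k.
  have p0 : 0 <= p by rewrite exprn_ge0.
  have Ep : 0 <= E * p by rewrite mulr_ge0.
  have := ler_wpM2l Ep (expT t); have := ler_wpM2l Ep (le_trans (e1 t) (expT t)).
  by rewrite mulr1; nra.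
exists y, (anti y); have [ay0 day] := antiP _ yC; split => //.
- move=> t t0; rewrite yE /step /ini (min_l t0) /tau /clamp min_l; last exact: le_trans T0.
  by rewrite max_l// ay0 addr0.
- move=> t; apply/ler_addgt0Pr => e e0.
  have e2 : 0 < e / (E + 1) by rewrite divr_gt0//; lra.
  have [k _ Hk] := half_pow_lt e2.
  have h1 := Xy k t; rewrite distrC in h1.
  rewrite -[y t](subrK (X k t)); apply: le_trans (ler_normD _ _) _.
  have h2 : `|X k t| <= E.
    by apply: le_trans (Xm k t) _; rewrite /wt ler_wpM2l// mulr_ge0.
  apply: le_trans (lerD h1 h2) _; rewrite addrC lerD2l.
  have := Hk k (leqnn k); rewrite /= ltr_pdivlMr; last by lra.
  have : 0 < (2^-1 : R) ^+ k by rewrite exprn_gt0.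
  nra.
- by move=> t tI; rewrite yE /step /ini /tau clamp_id//; case/andP: tI => t0 _; rewrite min_r.
Qed.

End Picard.

(** * Solutions of the retarded equation *)

Section DeriveShift.
Variables (R : realType) (n : nat).
Implicit Types x : R -> 'rV[R]_n.

Lemma is_derive_cvg x (t : R) (d : 'rV[R]_n) :
  is_derive t 1 x d -> h^-1 *: (x (h + t) - x t) @[h --> 0^'] --> d.
Proof.
move=> [dx <-]; have := dx; rewrite /derivable /derive.
suff -> : (fun h : R => h^-1 *: ((x \o shift t) (h *: 1) - x t)) =
    (fun h : R => h^-1 *: (x (h + t) - x t)) by [].
by apply/funext => h /=; rewrite scaler1.
Qed.

Lemma is_derive_shift x (t a : R) (d : 'rV[R]_n) :
  is_derive (t + a) 1 x d -> is_derive t 1 (fun s => x (s + a)) d.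
Proof.
move=> /is_derive_cvg dx.
have cd : h^-1 *: (((fun s => x (s + a)) \o shift t) (h *: 1) - x (t + a)) @[h --> 0^'] --> d.
  suff -> : (fun h : R => h^-1 *: (((fun s => x (s + a)) \o shift t) (h *: 1) - x (t + a))) =
    (fun h : R => h^-1 *: (x (h + (t + a)) - x (t + a))) by [].
  by apply/funext => h /=; rewrite scaler1 addrA.
by apply: DeriveDef; [apply/cvg_ex; exists d|apply/cvg_lim].
Qed.

Lemma is_derive_right x (t : R) (d : 'rV[R]_n) :
  is_derive t 1 x d -> s^-1 *: (x (s + t) - x t) @[s --> 0^'+] --> d.
Proof. by move=> /is_derive_cvg; exact: cvg_dnbhs_at_right. Qed.

Lemma is_derive_continuous x (t : R) (d : 'rV[R]_n) :
  is_derive t 1 x d -> {for t, continuous x}.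
Proof.
by move=> [dx _]; apply: differentiable_continuous; apply/derivable1_diffP.
Qed.

End DeriveShift.

(** * Continuity of the history in the uniform norm *)

Section History.
Variables (R : realType) (n : nat) (hM : R).
Hypothesis hM_ge0 : 0 <= hM.
Implicit Types x phi psi : R -> 'rV[R]_n.

Lemma continuous_history x t : continuous x -> continuous (history x t).
Proof.
move=> xC s.
have tC : {for s, continuous (fun s : R => t + s)} by apply: cvgD; [exact: cvg_cst|exact: cvg_id].
exact: (continuous_comp tC (xC _)).
Qed.

(** Compactness of [-hM, 0], in its near-covering form, makes the neighbourhood of t independent of
    s. *)
Lemma history_near x t (e : R) : continuous x -> 0 < e ->
  \forall t' \near t, forall s, - hM <= s <= 0 -> `|x (t' + s) - x (t + s)| < e.
Proof.
move=> xC e0.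
have /compact_near_coveringP cK := @segment_compact R (- hM) 0.
have H := cK _ (nbhs t) (fun t' s => `|x (t' + s) - x (t + s)| < e) _.
have [|] := H; last by move=> d d0 Hd; exists d => // t' /Hd h s sI; apply: h; rewrite /= in_itv.
move=> s _.
have e2 : 0 < e / 2 by rewrite divr_gt0.
have /cvgrPdist_lt/(_ _ e2)/nbhs_ballP[q /= q0 Hq] := xC (t + s).
exists (ball s (q / 2), ball t (q / 2)) => /=.
  by split; apply: nbhsx_ballx; rewrite divr_gt0.
move=> [s' t'] [/= bs bt].
have h1 : `|x (t + s) - x (t' + s')| < e / 2.
  apply: Hq; rewrite /ball/= opprD addrACA [ltRHS]splitr.
  by apply: le_lt_trans (ler_normD _ _) _; rewrite ltrD.
have h2 : `|x (t + s) - x (t + s')| < e / 2.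
  apply: Hq; rewrite /ball/= opprD addrACA subrr add0r.
  by apply: lt_trans bs _; lra.
rewrite (le_lt_trans (ler_distD (x (t + s)) _ _))// [ltRHS]splitr ltrD//.
by rewrite distrC.
Qed.

Lemma C0_eq phi psi : (forall s, - hM <= s <= 0 -> psi s = phi s) ->
  C0 hM phi -> C0 hM psi.
Proof.
move=> E phiC; apply: (subspace_eq_continuous _ phiC) => s.
by rewrite inE/= in_itv/= => /E.
Qed.

Lemma supnorm_eq phi psi : (forall s, - hM <= s <= 0 -> psi s = phi s) ->
  supnorm hM psi = supnorm hM phi.
Proof.
move=> E; rewrite /supnorm; congr sup; apply: eq_imagel => s.
by rewrite /= in_itv/= => /E ->.
Qed.

Lemma supnorm0 : supnorm hM (cst (0 : 'rV[R]_n)) = 0.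
Proof.
apply/eqP; rewrite eq_le supnorm_ge0//; last by apply: continuous_C0 => ?; exact: cvg_cst.
by rewrite andbT supnorm_le// => s _; rewrite enorm0.
Qed.

End History.

(** * Local uniqueness *)

Section Solutions.
Variables (R : realType) (r n : nat) (hM : R) (A : set 'rV[R]_r)
  (f : 'rV[R]_r -> (R -> 'rV[R]_n) -> 'rV[R]_n).
Hypothesis hM_gt0 : 0 < hM.
Hypothesis f_loc_lipschitz : rhs_locally_lipschitz hM A f.
Implicit Types (x y z : R -> 'rV[R]_n) (zeta : R -> 'rV[R]_r).

Let hM_ge0 : 0 <= hM := ltW hM_gt0.

(** [f] takes total functions on R, so its dependence on [-hM, 0] alone has to be derived: in the
    Lipschitz estimate centred at phi, all three distances are zero. *)
Lemma rhs_eq a phi psi : A a -> C0 hM phi ->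
  (forall s, - hM <= s <= 0 -> psi s = phi s) -> f a psi = f a phi.
Proof.
move=> Aa phiC E; have psiC := C0_eq E phiC.
have [d [L [d0 H]]] := f_loc_lipschitz Aa phiC.
have sup0 q : (forall s, - hM <= s <= 0 -> q s = phi s) -> supnorm hM (q \- phi) = 0.
  move=> Eq; rewrite -[RHS](@supnorm0 R n hM)//; apply: supnorm_eq => s sI /=.
  by rewrite Eq// subrr.
have := H a psi phi Aa psiC phiC.
rewrite (sup0 psi)// (sup0 phi)// subrr enorm0 mulr0 => /(_ d0 d0 d0) h.
apply/eqP; rewrite -subr_eq0 -normr_le0; exact: le_trans (norm_le_enorm _) h.
Qed.

(** This trades a solution continuous on a half-open interval for a function continuous on R.
    Freezing at T can destroy the derivative there, hence the open interval (0, T). *)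
Lemma solution_truncate x0 zeta tf x (T : R) :
  (forall t, 0 <= t -> A (zeta t)) ->
  solution hM f x0 zeta tf x -> 0 <= T -> (T%:E < tf)%E ->
  exists y, [/\ continuous y, (forall t, - hM <= t <= T -> y t = x t) &
    forall t : R, 0 < t < T -> is_derive t 1 y (f (zeta t) (history y t))].
Proof.
move=> zA [tf0 xC x0E _ dx] T0 Ttf.
have hT : - hM <= T by apply: le_trans T0; rewrite oppr_le0.
have xC' : {within `[(- hM), T], continuous x}.
  apply: continuous_subspaceW xC => t; rewrite /= in_itv/= => /andP[ht tT]; split => //.
  by apply: le_lt_trans Ttf; rewrite lee_fin.
have yC := continuous_comp_clamp hT xC'.
have yE t : - hM <= t <= T -> (x \o clamp (- hM) T) t = x t.
  by move=> tI; rewrite /= clamp_id.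
exists (x \o clamp (- hM) T); split => // t /andP[t0 tT].
have hyx : forall s, - hM <= s <= 0 -> history x t s = history (x \o clamp (- hM) T) t s.
  by move=> s /andP[hs s0]; rewrite /history yE//; apply/andP; split; lra.
rewrite -(rhs_eq (zA _ (ltW t0)) (continuous_C0 (@continuous_history _ _ _ t yC)) hyx).
have tI : t \in `](- hM), T[ by rewrite in_itv/= tT andbT; have := hM_gt0; lra.
apply: near_eq_is_derive (dx t t0 _); last by apply: lt_trans Ttf; rewrite lte_fin.
near=> s; rewrite yE//.
have : s \in `](- hM), T[ by near: s; exact: near_in_itvoo.
by rewrite in_itv/= => /andP[? ?]; rewrite !ltW.
Unshelve. all: by end_near. Qed.

(* On a short interval [tau, tau + d] the mean value inequality gives
   sup |x - y| <= sup |x - y| / 2. *)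
Lemma solution_unique_step zeta x y (tau T : R) :
  {within `[0, +oo[, continuous zeta} -> (forall t, 0 <= t -> A (zeta t)) ->
  continuous x -> continuous y ->
  (forall t : R, 0 < t < T -> is_derive t 1 x (f (zeta t) (history x t))) ->
  (forall t : R, 0 < t < T -> is_derive t 1 y (f (zeta t) (history y t))) ->
  0 <= tau < T -> (forall t, - hM <= t <= tau -> x t = y t) ->
  exists2 d : R, 0 < d & forall t, - hM <= t <= tau + d -> x t = y t.
Proof.
move=> zC zA xC yC dx dy /andP[tau0 tauT] xy.
have [d [L [d0 H]]] := f_loc_lipschitz (zA _ tau0) (continuous_C0 (hM := hM) (@continuous_history _ _ _ tau xC)).
(* L may be negative and the passage to the Euclidean sup norm costs [n.+1]; the added 1 makes L1
   positive. *)
pose L1 := `|L| * n.+1%:R + 1.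
have L1_gt0 : 0 < L1 by rewrite ltr_wpDl// mulr_ge0.
pose e := d / (2 * n.+1%:R).
have n0 : 0 < n.+1%:R :> R by rewrite ltr0n.
have e0 : 0 < e by rewrite divr_gt0// mulr_gt0.
have ed : n.+1%:R * e < d.
  have -> : n.+1%:R * e = d / 2 by rewrite /e; field; rewrite gt_eqF.
  lra.
have /nbhs_ballP[d1 /= d1_gt0 H1] := @history_near _ _ hM x tau e xC e0.
have /nbhs_ballP[d2 /= d2_gt0 H2] := @history_near _ _ hM y tau e yC e0.
have taI : `[0, +oo[%classic tau by rewrite /= in_itv/= tau0.
have [d3 /= d3_gt0 H3] : exists2 d3 : R, 0 < d3 &
    forall t, `|tau - t| < d3 -> 0 <= t -> enorm (zeta t - zeta tau) < d.
  have r0 : 0 < r.+1%:R :> R by rewrite ltr0n.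
  have e3 : 0 < d / (2 * r.+1%:R) by rewrite divr_gt0// mulr_gt0.
  have /subspace_continuousP/(_ _ taI)/cvgrPdist_lt/(_ _ e3) := zC.
  rewrite near_withinE => /nbhs_ballP[d3 /= d3_gt0 H3]; exists d3 => // t tt t0.
  have := H3 t tt; rewrite /= in_itv/= t0 distrC => /(_ isT) h.
  apply: le_lt_trans (enorm_le_norm _) _; apply: (@le_lt_trans _ _ (r.+1%:R * (d / (2 * r.+1%:R)))).
    by rewrite ler_wpM2l// ltW.
  have -> : r.+1%:R * (d / (2 * r.+1%:R)) = d / 2 by field; rewrite gt_eqF.
  lra.
(* On [tau, tau + de] both histories and zeta stay within d of their values at tau, times stay below
   T, and L1 * de <= 1/2 gives the contraction. *)
pose de := Num.min (Num.min (d1 / 2) (d2 / 2)) (Num.min (d3 / 2) (Num.min (T - tau) (2 * L1)^-1)).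
have de0 : 0 < de by rewrite !lt_min (divr_gt0 d1_gt0)// (divr_gt0 d2_gt0)//
  (divr_gt0 d3_gt0)// subr_gt0 tauT invr_gt0 mulr_gt0.
have de1 : de <= d1 / 2 by rewrite !ge_min lexx.
have de2 : de <= d2 / 2 by rewrite !ge_min lexx ?orbT.
have de3 : de <= d3 / 2 by rewrite !ge_min lexx ?orbT.
have deT : de <= T - tau by rewrite !ge_min lexx ?orbT.
have deL : L1 * de <= 2^-1.
  have : de <= (2 * L1)^-1 by rewrite !ge_min lexx ?orbT.
  by rewrite -ler_pdivlMl// invfM mulrC.
pose h t := x t - y t.
have hC : continuous h by move=> t; apply: cvgB; [exact: xC|exact: yC].
have hN : {within `[tau, tau + de], continuous (fun t => `|h t|)}.
  by apply: continuous_subspaceT => t; apply: cvg_norm; exact: hC.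
have taud : tau <= tau + de by rewrite lerDl ltW.
have [c /[!in_itv]/= /andP[c1 c2] hc] := EVT_max taud hN.
have h0 t : - hM <= t <= tau -> h t = 0 by move=> tI; rewrite /h xy// subrr.
have hall t : - hM <= t <= tau + de -> `|h t| <= `|h c|.
  move=> /andP[t1 t2]; have [tt|/ltW tt] := leP t tau; first by rewrite h0 ?normr0// t1.
  by apply: hc; rewrite in_itv/= tt.
have fL u : tau < u < tau + de ->
    `|f (zeta u) (history x u) - f (zeta u) (history y u)| <= L1 * `|h c|.
  move=> /andP[u1 u2]; have u0 : 0 <= u by lra.
  apply: le_trans (norm_le_enorm _) _.
  have near_hist z (q : R) : continuous z -> (forall t, - hM <= t <= tau -> z t = x t) ->
      (forall s, - hM <= s <= 0 -> `|z (u + s) - z (tau + s)| < e) ->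
      supnorm hM (history z u \- history x tau) < d.
    move=> zC' zx Hz; apply: le_lt_trans ed; apply: supnorm_le_norm => // s sI.
    rewrite ltW//= /history -zx; first exact: Hz.
    by move: sI => /andP[? ?]; apply/andP; split; lra.
  have uT : `|tau - u| <= de by rewrite ltr0_norm; lra.
  have := H (zeta u) (history x u) (history y u) (zA _ u0).
  have cxu := continuous_C0 (hM := hM) (@continuous_history _ _ _ u xC).
  have cyu := continuous_C0 (hM := hM) (@continuous_history _ _ _ u yC).
  move=> /(_ cxu cyu) H'.
  apply: le_trans (H' _ _ _) _.
  - by apply: H3 => //; lra.
  - by apply: near_hist => // s sI; apply: H1 => //; rewrite /ball/=; lra.
  - apply: near_hist => // [t tI|s sI]; first by rewrite xy.
    by apply: H2 => //; rewrite /ball/=; lra.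
  have hs : supnorm hM (history x u \- history y u) <= n.+1%:R * `|h c|.
    apply: supnorm_le_norm => // s /andP[s1 s2]; rewrite /= /history.
    by apply: hall; apply/andP; split; lra.
  have s0 := supnorm_ge0 hM_ge0 (C0B cxu cyu).
  apply: (@le_trans _ _ (`|L| * (n.+1%:R * `|h c|))).
    apply: (@le_trans _ _ (`|L| * supnorm hM (history x u \- history y u))).
      by rewrite ler_wpM2r// ler_norm.
    by rewrite ler_wpM2l.
  by rewrite mulrA /L1 mulrDl lerDl mul1r.
have hM1 : `|h c - h tau| <= L1 * `|h c| * c - L1 * `|h c| * tau.
  apply: (@mean_value_ineq _ _ h (fun u => f (zeta u) (history x u) - f (zeta u) (history y u))
    (fun u => L1 * `|h c| * u) (fun=> L1 * `|h c|)) => //.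
  - exact: continuous_subspaceT.
  - by apply: continuous_subspaceT => t; apply: cvgM; [exact: cvg_cst|exact: cvg_id].
  - by move=> u /andP[? ?]; apply: is_deriveB; [apply: dx|apply: dy]; apply/andP; split; lra.
  - by move=> u _; apply: is_derive_eq; rewrite /GRing.scale/=; ring.
  - by move=> u /andP[? ?]; apply: fL; apply/andP; split; lra.
have hc0 : `|h c| = 0.
  apply/eqP; rewrite eq_le normr_ge0 andbT.
  move: hM1; rewrite (h0 tau) ?lexx ?andbT ?subr0; last by have := hM_gt0; lra.
  have : 0 <= `|h c| by [].
  have k : L1 * (c - tau) <= 2^-1 by apply: le_trans deL; apply: (ler_wpM2l (ltW L1_gt0)); lra.
  move=> m0 hm; have := ler_wpM2l m0 k.
  have -> : `|h c| * (L1 * (c - tau)) = L1 * `|h c| * c - L1 * `|h c| * tau by ring.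
  by lra.
by exists de => // t /hall; rewrite hc0 normr_le0 subr_eq0 => /eqP.
Qed.

End Solutions.

(** * Global uniqueness, translation and gluing of solutions *)

Section Trajectories.
Variables (R : realType) (r n : nat) (hM : R) (A : set 'rV[R]_r)
  (f : 'rV[R]_r -> (R -> 'rV[R]_n) -> 'rV[R]_n).
Hypothesis hM_gt0 : 0 < hM.
Hypothesis f_loc_lipschitz : rhs_locally_lipschitz hM A f.
Implicit Types (x y z : R -> 'rV[R]_n) (zeta eta : R -> 'rV[R]_r).

(** Let tau be the supremum of the times up to which the solutions agree. Agreement at tau holds by
    continuity, and if tau < t the local step pushes it further, contradicting the supremum. *)
Lemma solution_unique x0 zeta tf tf' x y t :
  {within `[0, +oo[, continuous zeta} -> (forall t, 0 <= t -> A (zeta t)) ->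
  solution hM f x0 zeta tf x -> solution hM f x0 zeta tf' y ->
  - hM <= t -> (t%:E < tf)%E -> (t%:E < tf')%E -> x t = y t.
Proof.
move=> zC zA xsol ysol ht ttf ttf'.
have [_ _ x0E _ _] := xsol; have [_ _ y0E _ _] := ysol.
have [t0|/ltW t0] := leP t 0; first by rewrite x0E ?y0E ?ht.
have [x' [xC xE dx]] := solution_truncate hM_gt0 f_loc_lipschitz zA xsol t0 ttf.
have [y' [yC yE dy]] := solution_truncate hM_gt0 f_loc_lipschitz zA ysol t0 ttf'.
rewrite -xE ?ht ?lexx// -yE ?ht ?lexx//.
pose S := [set u : R | 0 <= u <= t /\ forall v, - hM <= v <= u -> x' v = y' v].
have S0 : S 0.
  split; first by rewrite lexx.
  move=> v /andP[hv v0]; rewrite xE ?yE ?x0E ?y0E ?hv ?(le_trans v0)//.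
have supS : has_sup S by split; [exists 0|exists t => u [/andP[]]].
pose tau := sup S.
have tau0 : 0 <= tau by apply: ub_le_sup S0; exact: supS.2.
have taut : tau <= t by apply: ge_sup; [exists 0|move=> u [/andP[]]].
have lt_tau v : - hM <= v -> v < tau -> x' v = y' v.
  move=> hv vtau; have e0 : 0 < tau - v by rewrite subr_gt0.
  have [u [_ Hu] vu] := sup_adherent e0 supS.
  by apply: Hu; rewrite hv ltW//; rewrite -/tau in vu; lra.
have eq_tau : x' tau = y' tau.
  apply/eqP; rewrite -subr_eq0 -normr_le0; apply/ler_addgt0Pr => e e0.
  have hC : {for tau, continuous (fun u => x' u - y' u)} by apply: cvgB; [exact: xC|exact: yC].
  have /cvgrPdist_lt/(_ _ e0)/nbhs_ballP[q /= q0 Hq] := hC.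
  (* Agreement is known only from -hM on, so the point approaching tau from the left must not go
     below it. *)
  pose v := Num.max (- hM) (tau - q / 2).
  have vtau : v < tau by rewrite gt_max; apply/andP; split; have := hM_gt0; lra.
  have hv : - hM <= v by rewrite le_max lexx.
  have := Hq v; rewrite /ball/= (lt_tau v)// subrr subr0 add0r => h; apply/ltW/h.
  rewrite gtr0_norm ?subr_gt0//.
  have : tau - q / 2 <= v by rewrite le_max lexx orbT.
  lra.
have le_tau v : - hM <= v <= tau -> x' v = y' v.
  move=> /andP[hv]; rewrite le_eqVlt => /orP[/eqP ->//|]; exact: lt_tau.
have [tt|tt] := leP t tau; first by apply: le_tau; rewrite ht.
have tauI : 0 <= tau < t by rewrite tau0.
have [d d0 Hd] := solution_unique_step hM_gt0 f_loc_lipschitz zC zA xC yC dx dy tauI le_tau.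
pose u := Num.min (tau + d) t.
have : S u.
  split; first by rewrite /u le_min ge_min lexx orbT andbT t0 andbT addr_ge0// ltW.
  by move=> v /andP[hv]; rewrite le_min => /andP[vd vt]; apply: Hd; rewrite hv.
move=> Su; have : u <= tau by apply: ub_le_sup Su; exact: supS.2.
rewrite /u; case: (leP (tau + d) t) => ? ?; exfalso; lra.
Qed.

(** A solution on all of R_+ is maximal since nothing exceeds +oo. It extends any other maximal
    solution by uniqueness, which forces that one to live up to +oo too. *)
Lemma trajectory_bounded_of_solution x0 zeta (b : R -> R) x :
  {within `[0, +oo[, continuous zeta} -> (forall t, 0 <= t -> A (zeta t)) ->
  solution hM f x0 zeta +oo%E x -> (forall t, 0 <= t -> enorm (x t) <= b t) ->
  trajectory_bounded hM f x0 zeta b.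
Proof.
move=> zC zA xsol xb; split.
  by exists x; split => // tf' y _; rewrite leye_eq => /eqP.
move=> tf y [ysol ymax].
have xy t : - hM <= t -> (t%:E < tf)%E -> x t = y t.
  by move=> ht ttf; apply: (solution_unique zC zA xsol ysol) => //; rewrite ltry.
have tfE : tf = +oo%E by rewrite -(ymax _ _ xsol (leey _) xy).
split => // t t0; rewrite -xy ?tfE ?ltry//; first exact: xb.
by rewrite (le_trans _ t0)// oppr_le0 ltW.
Qed.

Lemma solution_shift x0 zeta eta (a T : R) y :
  0 < a -> a < T -> continuous y ->
  solution hM f x0 zeta T%:E y -> (forall t, 0 <= t -> eta t = zeta (t + a)) ->
  solution hM f (history y a) eta (T - a)%:E (fun t => y (t + a)).
Proof.
move=> a0 aT yC [_ _ _ _ dy] etaE; split.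
- by rewrite lte_fin subr_gt0.
- apply: continuous_subspaceT => t.
  have tC : {for t, continuous (fun t : R => t + a)} by apply: cvgD; [exact: cvg_id|exact: cvg_cst].
  exact: (continuous_comp tC (yC _)).
- by move=> s _; rewrite /history addrC.
- have -> : history (fun t => y (t + a)) 0 = history y a.
    by apply/funext => s; rewrite /history add0r addrC.
  have -> : eta 0 = zeta a by rewrite etaE// add0r.
  rewrite add0r; apply: is_derive_right; apply: dy => //.
- move=> t t0; rewrite lte_fin => tT; apply: is_derive_shift.
  have -> : history (fun t => y (t + a)) t = history y (t + a).
    by apply/funext => s; rewrite /history addrAC.
  rewrite etaE ?ltW//; apply: dy; first exact: addr_gt0.
  by rewrite lte_fin; lra.
Qed.

(** By uniqueness y and the translate of z agree on [hM, T). Hence the glued function coincides with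
    y up to T, a neighbourhood of hM included, and with the translate of z from 0 on. *)
Lemma solution_glue x0 zeta eta (T : R) y z :
  {within `[0, +oo[, continuous zeta} -> (forall t, 0 <= t -> A (zeta t)) ->
  {within `[0, +oo[, continuous eta} ->
  hM < T -> continuous y ->
  solution hM f x0 zeta T%:E y -> (forall t, 0 <= t -> eta t = zeta (t + hM)) ->
  solution hM f (history y hM) eta +oo%E z ->
  solution hM f x0 zeta +oo%E (fun t => if t <= hM then y t else z (t - hM)).
Proof.
move=> zC zA eC hT yC ysol etaE zsol.
have eA t : 0 <= t -> A (eta t).
  by move=> t0; rewrite etaE//; apply: zA; rewrite addr_ge0// ltW.
have ysol' := solution_shift hM_gt0 hT yC ysol etaE.
have [_ _ y0E dy0 dy] := ysol; have [_ _ z0E _ dz] := zsol.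
set Y := fun t => _.
have Yy t : - hM <= t -> t < T -> Y t = y t.
  move=> ht tT; rewrite /Y; case: ifPn => //; rewrite -ltNge => th.
  rewrite (solution_unique (t := t - hM) eC eA zsol ysol') ?subrK ?ltry ?lte_fin//; last by lra.
  by have := hM_gt0; lra.
have Yz t : 0 <= t -> Y t = z (t - hM).
  move=> t0; rewrite /Y; case: ifPn => // th; rewrite z0E; last by apply/andP; split; lra.
  by rewrite /history addrC subrK.
have h0 := hM_gt0.
have dY (t : R) : 0 < t -> is_derive t 1 Y (f (zeta t) (history Y t)).
  move=> t0; have [th|th] := leP t hM.
    have tT : t < T by lra.
    have -> : f (zeta t) (history Y t) = f (zeta t) (history y t).
      apply: (rhs_eq hM_gt0 f_loc_lipschitz (zA _ (ltW t0))).
        by apply: continuous_C0; exact: continuous_history.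
      by move=> s /andP[s1 s2]; rewrite /history Yy//; lra.
    apply: near_eq_is_derive (dy t t0 _); last by rewrite lte_fin.
    near=> s; have : s \in `]0, T[ by near: s; apply: near_in_itvoo; rewrite in_itv/= t0.
    by rewrite in_itv/= => /andP[? ?]; rewrite Yy//; lra.
  have tz : 0 < t - hM by rewrite subr_gt0.
  have -> : f (zeta t) (history Y t) = f (eta (t - hM)) (history z (t - hM)).
    rewrite etaE ?ltW// subrK.
    have hz : forall s, - hM <= s <= 0 -> history Y t s = history z (t - hM) s.
      move=> s /andP[s1 s2]; have ts : 0 <= t + s by lra.
      by rewrite /history (Yz _ ts) addrAC.
    apply: (rhs_eq hM_gt0 f_loc_lipschitz (zA _ (ltW t0))) => //.
    have [z' [z'C z'E _]] := solution_truncate hM_gt0 f_loc_lipschitz eA zsol (ltW tz) (ltry _).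
    apply: (C0_eq (phi := history z' (t - hM))).
      by move=> s /andP[s1 s2]; rewrite /history z'E//; apply/andP; split; lra.
    by apply: continuous_C0; exact: continuous_history.
  have dz' : is_derive t 1 (fun s => z (s - hM)) (f (eta (t - hM)) (history z (t - hM))).
    by apply: is_derive_shift; apply: dz => //; rewrite ltry.
  apply: near_eq_is_derive dz'.
  near=> s; have : s \in `]0, t + 1[.
    by near: s; apply: near_in_itvoo; rewrite in_itv/= t0/= ltrDl ltr01.
  by rewrite in_itv/= => /andP[? ?]; rewrite Yz//; lra.
split.
- by rewrite ltry.
- apply/subspace_continuousP => t [ht _].
  have [t0|t0] := leP t 0; last first.
    by apply: cvg_within_filter; exact: (is_derive_continuous (dY t t0)).
  have Yt : Y t = y t by apply: Yy => //; lra.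
  suff : Y s @[s --> within [set s | - hM <= s /\ (s%:E < +oo)%E] (nbhs t)] --> y t.
    by rewrite -Yt.
  have yt : y s @[s --> within [set s | - hM <= s /\ (s%:E < +oo)%E] (nbhs t)] --> y t.
    by apply: cvg_within_filter; exact: yC.
  apply: cvg_trans yt; apply: near_eq_cvg; rewrite near_withinE; near=> s => -[hs _].
  have : s \in `](- hM - 1), T[.
    by near: s; apply: near_in_itvoo; rewrite in_itv/=; apply/andP; split; lra.
  by rewrite in_itv/= => /andP[? ?]; rewrite Yy.
- move=> s /andP[s1 s2]; rewrite Yy//; last by lra.
  by apply: y0E; rewrite s1.
- have -> : f (zeta 0) (history Y 0) = f (zeta 0) (history y 0).
    apply: (rhs_eq hM_gt0 f_loc_lipschitz (zA _ (lexx 0))).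
      by apply: continuous_C0; exact: continuous_history.
    by move=> s /andP[s1 s2]; rewrite /history Yy//; lra.
  apply: cvg_trans dy0; apply: near_eq_cvg; near=> s.
  have s0 : 0 < s by near: s; exact: nbhs_right_gt.
  have sT : s < T by near: s; apply: nbhs_right_lt; lra.
  by rewrite !Yy//; lra.
- by move=> t t0 _; exact: dY.
Unshelve. all: by end_near. Qed.

End Trajectories.

(** * Existence on a prescribed horizon for truncated values *)

Section ShortTimeExistence.
Variables (R : realType) (r n : nat) (hM : R) (A : set 'rV[R]_r)
  (f : 'rV[R]_r -> (R -> 'rV[R]_n) -> 'rV[R]_n).
Hypothesis hM_gt0 : 0 < hM.
Hypothesis f_continuous : rhs_continuous hM A f.
Hypothesis f_zero : forall a, A a -> f a (cst 0) = 0.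
Hypothesis f_loc_lipschitz : rhs_locally_lipschitz hM A f.
Implicit Types (x y z : R -> 'rV[R]_n) (zeta : R -> 'rV[R]_r).

Let hM_ge0 : 0 <= hM := ltW hM_gt0.

(** [Num.max 0 t] extends zeta continuously to negative times. The history is a continuous path for
    uniform convergence, and the nonexpansive P preserves this. *)
Lemma continuous_rhs_history (P : 'rV[R]_n -> 'rV[R]_n) zeta x :
  (forall u v, `|P u - P v| <= `|u - v|) ->
  {within `[0, +oo[, continuous zeta} -> (forall t, 0 <= t -> A (zeta t)) ->
  continuous x ->
  continuous (fun t : R => f (zeta (Num.max 0 t)) (P \o history x t)).
Proof.
move=> PL zC zA xC t0.
have PC : continuous P := nonexpansive_continuous PL.
have zmC : continuous (fun t : R => zeta (Num.max 0 t)).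
  move=> t; have tI : `[0, +oo[%classic (Num.max 0 t) by rewrite /= in_itv/= andbT le_max lexx.
  have /subspace_continuousP/(_ _ tI) zt := zC.
  move=> U /zt; rewrite /within/= => VU.
  apply: (@filterS _ (nbhs t) _ _ _ _ (@continuous_max0 _ t _ VU)) => s /=; apply.
  by rewrite in_itv/= andbT le_max lexx.
have A0 t : A (zeta (Num.max 0 t)) by apply: zA; rewrite le_max lexx.
have hC t : C0 hM (P \o history x t).
  apply: continuous_C0 => s.
  exact: (continuous_comp (@continuous_history _ _ x t xC s) (PC _)).
pose u t : 'rV[R]_r * {uniform` `[(- hM), 0]%classic -> 'rV[R]_n} :=
  (zeta (Num.max 0 t), P \o history x t).
have uD t : [set p : 'rV[R]_r * {uniform` `[(- hM), 0]%classic -> 'rV[R]_n} |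
    A p.1 /\ C0 hM p.2] (u t) by split; [exact: A0|exact: hC].
pose w t : {uniform` `[(- hM), 0]%classic -> 'rV[R]_n} := P \o history x t.
have wC : w t @[t --> t0] --> w t0.
  move=> U /uniform_nbhs[E [entE EU]].
  move: entE; rewrite -entourage_from_ballE => -[e /= e0 eE].
  have xt := @history_near _ _ hM x t0 e xC e0.
  apply: (@filterS _ (nbhs t0) _ _ _ _ xt) => t Ht; apply: EU => s; rewrite /= in_itv/= => sI.
  apply: eE; rewrite /= -ball_normE/=; apply: le_lt_trans (PL _ _) _.
  by rewrite distrC; exact: Ht.
have uC : u t @[t --> t0] --> u t0 by exact: (cvg_pair (zmC t0) wC).
have /subspace_continuousP/(_ _ (uD t0)) fC := f_continuous.
move=> U /fC; rewrite /within/= => VU.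
by apply: (@filterS _ (nbhs t0) _ _ _ _ (uC _ VU)) => s /=; apply.
Unshelve. all: by end_near. Qed.

(* [P] truncates the values so that only the Lipschitz estimate on [S] is used;
   a Picard solution of the truncated equation which [P] leaves unchanged
   solves the original one. *)
Lemma short_time_solution (S : set (R -> 'rV[R]_n)) (P : 'rV[R]_n -> 'rV[R]_n) (T : R) :
  rhs_lipschitz_on hM A S f ->
  (forall u v, `|P u - P v| <= `|u - v|) -> P 0 = 0 ->
  (forall phi, C0 hM phi -> S (P \o phi)) -> 0 < T ->
  exists2 M : R, 0 < M & forall x0 zeta, C0 hM x0 ->
    {within `[0, +oo[, continuous zeta} -> (forall t, 0 <= t -> A (zeta t)) ->
    exists y g : R -> 'rV[R]_n,
    [/\ continuous y, continuous g,
        (forall t, `|y t| <= M * supnorm hM x0),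
        (forall t, 0 <= t -> `|g t| <= M * supnorm hM x0) &
        (forall t : R, 0 < t < T -> is_derive t 1 y (g t)) /\
        ((forall t, P (y t) = y t) -> solution hM f x0 zeta T%:E y)].
Proof.
move=> [L fL] PL P0 PS T0.
pose Lp := `|L| * n.+1%:R + 1; have Lp0 : 0 < Lp by rewrite ltr_wpDl// mulr_ge0.
have L1 : 1 <= Lp + 1 by rewrite lerDr ltW.
have e0 : 0 < expR (2 * Lp * T) by exact: expR_gt0.
(* The Picard bound on y is 2 exp (2 Lp T) times the sup norm and its derivative costs a further Lp;
   the factor Lp + 1 covers both. *)
exists ((Lp + 1) * (2 * expR (2 * Lp * T))); first by rewrite !mulr_gt0//; lra.
move=> x0 zeta x0C zC zA.
pose Phi x t := f (zeta (Num.max 0 t)) (P \o history x t).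
have PC : continuous P := nonexpansive_continuous PL.
have PhC x t : continuous x -> C0 hM (P \o history x t).
  move=> xC; apply: continuous_C0 => s.
  exact: (continuous_comp (@continuous_history _ _ x t xC s) (PC _)).
have A0 t : A (zeta (Num.max 0 t)) by apply: zA; rewrite le_max lexx.
have PhiC x : continuous x -> continuous (Phi x) by exact: continuous_rhs_history.
have PhiL x y M t : continuous x -> continuous y -> 0 <= t ->
    (forall s, s <= t -> `|x s - y s| <= M) -> `|Phi x t - Phi y t| <= Lp * M.
  move=> xC yC t0 xyM; have M0 : 0 <= M := le_trans (normr_ge0 _) (xyM t (lexx t)).
  have cx := PhC x t xC; have cy := PhC y t yC.
  have Sx : S (P \o history x t) by apply: PS; apply: continuous_C0; exact: continuous_history.
  have Sy : S (P \o history y t) by apply: PS; apply: continuous_C0; exact: continuous_history.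
  apply: le_trans (norm_le_enorm _) _.
  apply: le_trans (fL _ _ _ (A0 t) cx Sx cy Sy) _.
  have hs : supnorm hM ((P \o history x t) \- (P \o history y t)) <= n.+1%:R * M.
    apply: supnorm_le_norm => // s /andP[_ s0]; apply: le_trans (PL _ _) _.
    by apply: xyM; rewrite gerDl.
  have s0 := supnorm_ge0 hM_ge0 (C0B cx cy).
  apply: (@le_trans _ _ (`|L| * (n.+1%:R * M))).
    apply: (@le_trans _ _ (`|L| * supnorm hM ((P \o history x t) \- (P \o history y t)))).
      by rewrite ler_wpM2r// ler_norm.
    by rewrite ler_wpM2l.
  by rewrite mulrA /Lp mulrDl lerDl mul1r.
have Phi0 t : 0 <= t -> Phi (cst 0) t = 0.
  move=> _; rewrite /Phi (_ : P \o _ = cst 0) ?f_zero//.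
  by apply/funext => s; rewrite /= /history/= P0.
have hM0 : - hM <= 0 by rewrite oppr_le0.
have x0eC := continuous_comp_clamp hM0 x0C.
have m0 := supnorm_ge0 hM_ge0 x0C.
have x0m t : `|(x0 \o clamp (- hM) 0) t| <= supnorm hM x0.
  by apply: (norm_le_supnorm hM_ge0 x0C); exact: clamp_itv.
have [y [G [yC y0 yM dG yG]]] := picard Lp0 PhiC PhiL Phi0 (ltW T0) x0eC x0m.
have yM' t : `|y t| <= (Lp + 1) * (2 * expR (2 * Lp * T)) * supnorm hM x0.
  apply: le_trans (yM t) _.
  have -> : 2 * supnorm hM x0 * expR (2 * Lp * T) = 2 * expR (2 * Lp * T) * supnorm hM x0 by ring.
  by rewrite -[leRHS]mulrA ler_peMl// mulr_ge0// mulr_ge0// ltW.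
have y0E : y 0 = x0 0 by rewrite y0// /= clamp_id// lexx hM0.
have G0 : G 0 = 0.
  have := yG 0; rewrite lexx (ltW T0) => /(_ isT).
  rewrite y0E /= clamp_id ?lexx ?hM0// => E.
  by apply: (addrI (x0 0)); rewrite addr0 -E.
have yGE t : 0 <= t <= T -> y t = x0 0 + G t.
  by move=> /yG ->; rewrite /= clamp_id// lexx hM0.
(* [Phi y] is continuous on all of R, so its history at hM can later serve as a weak derivative. *)
exists y, (Phi y); split => //.
- exact: PhiC.
- move=> t t0; rewrite -[Phi y t]subr0 -(Phi0 _ t0).
  apply: (@le_trans _ _ (Lp * (2 * supnorm hM x0 * expR (2 * Lp * T)))).
    apply: PhiL => //; first by move=> ?; exact: cvg_cst.
    by move=> s _; rewrite subr0.
  have -> : (Lp + 1) * (2 * expR (2 * Lp * T)) * supnorm hM x0 =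
    (Lp + 1) * (2 * supnorm hM x0 * expR (2 * Lp * T)) by ring.
  by rewrite ler_wpM2r ?lerDl// mulr_ge0 ?expR_ge0// mulr_ge0.
have dy (t : R) : 0 < t < T -> is_derive t 1 y (Phi y t).
  move=> /andP[t0 tT].
  have dcG : is_derive t 1 (fun s => x0 0 + G s) (Phi y t).
    by rewrite -[Phi y t]add0r; apply: is_deriveD; apply: dG; lra.
  apply: near_eq_is_derive dcG; near=> s.
  have : s \in `]0, T[ by near: s; apply: near_in_itvoo; rewrite in_itv/= t0.
  by rewrite in_itv/= => /andP[? ?]; rewrite yGE// !ltW.
split=> [//|Py].
have PhiE t : 0 <= t -> Phi y t = f (zeta t) (history y t).
  by move=> t0; rewrite /Phi max_r//; congr (f _ _); apply/funext => s; exact: Py.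
split.
- by rewrite lte_fin.
- exact: continuous_subspaceT.
- by move=> s /andP[hs s0]; rewrite y0//= clamp_id// hs.
- rewrite -PhiE//.
  have := is_derive_right (dG 0 (ltrN10 _)).
  apply: cvg_trans; apply: near_eq_cvg; near=> s.
  have s0 : 0 < s by near: s; exact: nbhs_right_gt.
  have sT : s < T by near: s; exact: nbhs_right_lt.
  by rewrite addr0 G0 subr0 y0E yGE ?ltW// addrC addKr.
- by move=> t t0; rewrite lte_fin => tT; rewrite -PhiE ?ltW//; apply: dy; rewrite t0.
Unshelve. all: by end_near. Qed.

End ShortTimeExistence.

(** * From continuous data to W after one delay *)

Section Regularization.
Variables (R : realType) (r n : nat) (hM : R) (A : set 'rV[R]_r)
  (f : 'rV[R]_r -> (R -> 'rV[R]_n) -> 'rV[R]_n).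
Hypothesis hM_gt0 : 0 < hM.
Hypothesis f_continuous : rhs_continuous hM A f.
Hypothesis f_zero : forall a, A a -> f a (cst 0) = 0.
Hypothesis f_loc_lipschitz : rhs_locally_lipschitz hM A f.

(** The horizon [2 * hM] exceeds the restart time hM, which leaves the overlap required by
    [solution_glue]. *)
Definition regularizes_to_W (rho : \bar R) (M K : R) : Prop :=
  forall (x0 : R -> 'rV[R]_n) (zeta : R -> 'rV[R]_r),
    C0 hM x0 -> ((supnorm hM x0)%:E < rho)%E ->
    {within `[0, +oo[, continuous zeta} -> (forall t, 0 <= t -> A (zeta t)) ->
    exists y : R -> 'rV[R]_n, [/\ continuous y, solution hM f x0 zeta (2 * hM)%:E y,
      (forall t, enorm (y t) <= M * supnorm hM x0),
      W hM (history y hM) & Wnorm hM (history y hM) <= K * supnorm hM x0].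

(** Data below rho give solutions of norm less than [radius], where P acts as the identity. An
    infinite radius with P = id covers the global case. *)
Lemma regularization (S : set (R -> 'rV[R]_n)) (P : 'rV[R]_n -> 'rV[R]_n)
    (radius : \bar R) :
  rhs_lipschitz_on hM A S f ->
  (forall u v, `|P u - P v| <= `|u - v|) -> P 0 = 0 ->
  (forall phi, C0 hM phi -> S (P \o phi)) ->
  (0 < radius)%E -> (forall v, (`|v|%:E < radius)%E -> P v = v) ->
  exists M1 M K : R, [/\ 0 < M1, 0 < M, 0 < K &
    forall rho, (forall s, (s%:E < rho)%E -> ((M1 * s)%:E < radius)%E) ->
      regularizes_to_W rho M K].
Proof.
move=> fL PL P0 PS c0 Pid.
have T0 : 0 < 2 * hM by rewrite mulr_gt0.
have [M1 M1_gt0 H] := short_time_solution hM_gt0 f_continuous f_zero fL PL P0 PS T0.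
have h0 := hM_gt0.
exists M1, (n.+1%:R * M1), (n.+1%:R * (M1 + (1 + hM) * M1)); split => //.
- by rewrite mulr_gt0.
- by rewrite mulr_gt0// addr_gt0// mulr_gt0// addr_gt0.
move=> rho Hrho x0 zeta x0C x0rho zC zA.
have [y [g [yC gC yM gM [dy ysol]]]] := H x0 zeta x0C zC zA.
exists y.
have Py t : P (y t) = y t.
  by apply: Pid; apply: le_lt_trans (Hrho _ x0rho); rewrite lee_fin.
have gC' : continuous (history g hM) by exact: continuous_history.
have yC' : continuous (history y hM) by exact: continuous_history.
have dy' (s : R) : - hM < s < 0 -> is_derive s 1 (history y hM) (history g hM s).
  move=> /andP[s1 s2]; rewrite (_ : history y hM = fun s => y (s + hM)); last first.
    by apply/funext => u; rewrite /history addrC.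
  by apply: is_derive_shift; rewrite /history addrC; apply: dy; apply/andP; split; lra.
have gB (s : R) : - hM <= s <= 0 -> `|history g hM s| <= M1 * supnorm hM x0.
  by move=> /andP[s1 s2]; apply: gM; lra.
have [yW yN] := C1_W hM_gt0 yC' gC' dy' gB.
split; [exact: yC|exact: ysol| |exact: yW|].
- by move=> t; apply: le_trans (enorm_le_norm _) _; rewrite -mulrA ler_wpM2l.
- apply: le_trans yN _; rewrite -[leRHS]mulrA ler_wpM2l// [leRHS]mulrDl -[X in _ <= _ + X]mulrA lerD2r.
  by rewrite /history addr0; exact: yM.
Qed.

Lemma regularization_global : rhs_lipschitz_on hM A setT f ->
  exists M K : R, [/\ 0 < M, 0 < K & regularizes_to_W +oo%E M K].
Proof.
move=> fL.
have [M1 [M [K [_ M0 K0 H]]]] := @regularization setT id +oo%E fL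
  (fun u v => lexx _) (erefl _) (fun _ _ => I) (ltry 0) (fun _ _ => erefl _).
exists M, K; split => //; apply: H => s _; exact: ltry.
Qed.

Lemma regularization_local (H : R) : 0 < H ->
  rhs_lipschitz_on hM A [set phi | supnorm hM phi <= H] f ->
  exists rho M K : R, [/\ 0 < rho, 0 < M, 0 < K & regularizes_to_W rho%:E M K].
Proof.
move=> H0 fL.
(* Coordinates in [-c, c] give a Euclidean norm at most [n.+1] * c = H, so truncated histories lie
   in the ball where f is Lipschitz. *)
pose c := H / n.+1%:R; have c0 : 0 < c by rewrite divr_gt0.
have cc : - c <= c by lra.
pose P (v : 'rV[R]_n) : 'rV[R]_n := \row_i clamp (- c) c (v 0 i).
have PL u v : `|P u - P v| <= `|u - v|.
  apply: rV_norm_le => // i; rewrite !mxE; apply: le_trans (clamp_lipschitz cc _ _) _.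
  by have := norm_coord_le (u - v) i; rewrite !mxE.
have Pid v : (`|v|%:E < c%:E)%E -> P v = v.
  rewrite lte_fin => vc; apply/rowP => i; rewrite mxE clamp_id//.
  by rewrite -ler_norml; apply: le_trans (norm_coord_le _ _) (ltW vc).
have P0 : P 0 = 0 by apply: Pid; rewrite normr0 lte_fin.
have PS (phi : R -> 'rV[R]_n) : C0 hM phi -> [set phi | supnorm hM phi <= H] (P \o phi).
  move=> _ /=; have -> : H = n.+1%:R * c by rewrite /c mulrC divfK.
  apply: (supnorm_le_norm (ltW hM_gt0)) => s _; apply: rV_norm_le => [|i]; first exact: ltW.
  by rewrite mxE ler_norml; exact: clamp_itv.
have [|M1 [M [K [M10 M0 K0 reg]]]] := regularization fL PL P0 PS _ Pid; first by rewrite lte_fin.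
exists (c / M1), M, K; split => //; first by rewrite divr_gt0.
by apply: reg => s; rewrite !lte_fin ltr_pdivlMr// mulrC.
Qed.

End Regularization.

(** * Transfer of decay estimates between the two spaces *)

Section Transfer.
Variables (R : realType) (r n : nat) (hM : R) (A : set 'rV[R]_r)
  (f : 'rV[R]_r -> (R -> 'rV[R]_n) -> 'rV[R]_n) (HH : set (R -> 'rV[R]_r)).
Hypothesis hM_gt0 : 0 < hM.
Hypothesis f_loc_lipschitz : rhs_locally_lipschitz hM A f.
Hypothesis HH_continuous : forall zeta, HH zeta -> {within `[0, +oo[, continuous zeta}.
Hypothesis HH_invariant : forward_invariant HH.
Hypothesis HH_in_A : forall zeta (t : R), HH zeta -> 0 <= t -> A (zeta t).

(** Monotonicity in the size of the data is packed into the comparison between beta and beta', so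
    stability, asymptotic stability and exponential stability all use the same lemma. *)
Lemma decay_estimate_W_of_C0 (K : R) (beta beta' : R -> R -> R) (rho rho' : \bar R) :
  (forall phi : R -> 'rV[R]_n, W hM phi -> supnorm hM phi <= K * Wnorm hM phi) ->
  (forall s, 0 <= s -> (s%:E < rho')%E -> ((K * s)%:E < rho)%E) ->
  (forall s u t, 0 <= u -> u <= K * s -> 0 <= t -> beta u t <= beta' s t) ->
  decay_estimate hM f (C0 hM) (supnorm hM) HH beta rho ->
  decay_estimate hM f (W hM) (Wnorm hM) HH beta' rho'.
Proof.
move=> supK rho12 beta12 est x0 zeta x0W x0rho zHH.
have x0C := W_C0 x0W; have s0 := supnorm_ge0 (ltW hM_gt0) x0C.
have N0 : 0 <= Wnorm hM x0 by exact: sqrtr_ge0.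
have [ex bd] : trajectory_bounded hM f x0 zeta (beta (supnorm hM x0)).
  apply: est => //; apply: le_lt_trans (rho12 _ N0 x0rho).
  by rewrite lee_fin supK.
split=> // tf x /bd[tfE xb]; split => // t t0.
by apply: le_trans (xb t t0) _; apply: beta12 => //; exact: supK.
Qed.

(** Two demands on beta': dominate the linear bound during the first delay, then the W estimate
    restarted at hM and hence read at time t - hM. *)
Lemma decay_estimate_C0_of_W (M K : R) (beta beta' : R -> R -> R) (rho rho' rho0 : \bar R) :
  regularizes_to_W hM A f rho0 M K ->
  (forall s, 0 <= s -> (s%:E < rho')%E -> (s%:E < rho0)%E /\ ((K * s)%:E < rho)%E) ->
  (forall s t, 0 <= s -> 0 <= t <= hM -> M * s <= beta' s t) ->
  (forall s u t, 0 <= u -> u <= K * s -> hM <= t -> beta u (t - hM) <= beta' s t) ->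
  decay_estimate hM f (W hM) (Wnorm hM) HH beta rho ->
  decay_estimate hM f (C0 hM) (supnorm hM) HH beta' rho'.
Proof.
move=> reg rho12 beta1 beta2 est x0 zeta x0C x0rho zHH.
have s0 := supnorm_ge0 (ltW hM_gt0) x0C.
have zC := HH_continuous zHH.
have zA t : 0 <= t -> A (zeta t) by exact: HH_in_A.
have [rho1 rho2] := rho12 _ s0 x0rho.
have [y [yC ysol yM yW yN]] := reg _ _ x0C rho1 zC zA.
have [eta etaHH etaE] := HH_invariant zHH hM_gt0.
have eC := HH_continuous etaHH.
have N0 : 0 <= Wnorm hM (history y hM) by exact: sqrtr_ge0.
have [[z zmax] bd] : trajectory_bounded hM f (history y hM) eta (beta (Wnorm hM (history y hM))).
  by apply: est => //; apply: le_lt_trans rho2; rewrite lee_fin.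
have [_ zb] := bd _ _ zmax; have [zsol _] := zmax.
have hT : hM < 2 * hM by have := hM_gt0; lra.
apply: (trajectory_bounded_of_solution hM_gt0 f_loc_lipschitz zC zA
  (solution_glue hM_gt0 f_loc_lipschitz zC zA eC hT yC ysol etaE zsol)).
move=> t t0 /=; case: ifPn => [th|].
  by apply: le_trans (yM t) _; apply: beta1 => //; rewrite t0.
rewrite -ltNge => th; apply: le_trans (zb _ _) _; first by rewrite subr_ge0 ltW.
by apply: beta2 => //; exact: ltW.
Qed.

End Transfer.

(** * Comparison functions *)

Section ComparisonFunctions.
Variable R : realType.
Implicit Types (alpha : R -> R) (beta : R -> R -> R).

Lemma classK_ge0 alpha s : classK alpha -> 0 <= s -> 0 <= alpha s.
Proof.
move=> [_ incr a0]; rewrite le_eqVlt => /orP[/eqP <-|s0]; first by rewrite a0.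
by rewrite -a0 ltW// incr.
Qed.

Lemma classK_le alpha s t : classK alpha -> 0 <= s -> s <= t -> alpha s <= alpha t.
Proof.
move=> [_ incr _] s0; rewrite le_eqVlt => /orP[/eqP ->//|st].
by rewrite ltW// incr.
Qed.

(** One comparison function for both phases of a trajectory: the linear term for the first delay,
    alpha (K s) for the restarted estimate. *)
Lemma classK_comp alpha (a K : R) : classK alpha -> 0 < a -> 0 < K ->
  classK (fun s => a * s + alpha (K * s)).
Proof.
move=> [aC incr a0] a_gt0 K0; split.
- apply/subspace_continuousP => s; rewrite /= in_itv/= andbT => s0.
  have lC b : {for s, continuous (fun t : R => b * t)}.
    by apply: cvgM; [exact: cvg_cst|exact: cvg_id].
  apply: cvgD; first by apply: cvg_within_filter; exact: lC.
  have Ks0 : `[0, +oo[%classic (K * s) by rewrite /= in_itv/= andbT mulr_ge0// ltW.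
  move/subspace_continuousP : aC => /(_ _ Ks0) aC.
  move=> U /aC; rewrite /within/= => VU.
  apply: (@filterS _ (nbhs s) _ _ _ _ (lC K _ VU)) => t /= H.
  by rewrite !in_itv/= !andbT in H * => t0; apply: H; rewrite mulr_ge0// ltW.
- move=> s s' s0 ss'; rewrite ltrD ?ltr_pM2l//; apply: incr; last by rewrite ltr_pM2l.
  by rewrite mulr_ge0// ltW.
- by rewrite !mulr0 a0 addr0.
Qed.

Lemma classKL_noninc beta s t t' : classKL beta -> 0 <= s -> 0 <= t -> t <= t' ->
  beta s t' <= beta s t.
Proof.
move=> [_ bK decr _] s0 t0; rewrite le_eqVlt => /orP[/eqP ->//|tt'].
move: s0; rewrite le_eqVlt => /orP[/eqP <-|s0]; last by rewrite ltW// decr.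
have [_ _ ->] := bK t t0; have [_ _ ->//] := bK t' (le_trans t0 (ltW tt')).
Qed.

Lemma classKL_ge0 beta s t : classKL beta -> 0 <= s -> 0 <= t -> 0 <= beta s t.
Proof. by move=> [_ bK _ _] s0 t0; exact: classK_ge0 (bK t t0) s0. Qed.

Lemma classKL_le beta s s' t : classKL beta -> 0 <= s -> s <= s' -> 0 <= t ->
  beta s t <= beta s' t.
Proof. by move=> [_ bK _ _] s0 ss' t0; exact: classK_le (bK t t0) s0 ss'. Qed.

(* [beta] delayed by [h], plus an exponential term that makes the sum strictly
   decreasing in time even on [0, h]. *)
Definition delayed_KL (a c h K : R) beta : R -> R -> R :=
  fun s t => a * expR (c - t) * s + beta (K * s) (Num.max 0 (t - h)).

Lemma classKL_delayed beta (a c h K : R) : classKL beta -> 0 < a -> 0 < K -> 0 <= h ->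
  classKL (delayed_KL a c h K beta).
Proof.
move=> bKL a0 K0 h0; have [bC bK bdecr blim] := bKL.
have m0 t : 0 <= Num.max 0 (t - h) by rewrite le_max lexx.
have eC : continuous (fun t : R => expR (c - t)).
  move=> t; have lC : {for t, continuous (fun t : R => c - t)}.
    by apply: cvgB; [exact: cvg_cst|exact: cvg_id].
  exact: (continuous_comp lC (@continuous_expR _ _)).
have mC : continuous (fun t : R => Num.max 0 (t - h)).
  move=> t; have lC : {for t, continuous (fun t : R => t - h)}.
    by apply: cvgB; [exact: cvg_id|exact: cvg_cst].
  exact: (continuous_comp lC (@continuous_max0 _ _)).
split.
- apply/subspace_continuousP => -[s t] /= [s0 t0].
  have fstC : p.1 @[p --> (s, t)] --> s by exact: cvg_fst.
  have sndC : p.2 @[p --> (s, t)] --> t by exact: cvg_snd.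
  apply: (@cvgD _ _ _ _ _ (fun p : R * R => a * expR (c - p.2) * p.1)
    (fun p : R * R => beta (K * p.1) (Num.max 0 (p.2 - h)))).
    apply: cvg_within_filter; apply: cvgM => //; apply: cvgM; first exact: cvg_cst.
    exact: (cvg_comp _ _ sndC (eC t)).
  have qC : (K * p.1, Num.max 0 (p.2 - h)) @[p --> (s, t)] --> (K * s, Num.max 0 (t - h)).
    have c1 : K * p.1 @[p --> (s, t)] --> K * s by apply: cvgM => //; exact: cvg_cst.
    exact: (cvg_pair c1 (cvg_comp _ _ sndC (mC t))).
  have qI : [set p : R * R | 0 <= p.1 /\ 0 <= p.2] (K * s, Num.max 0 (t - h)).
    by split => //=; rewrite mulr_ge0// ltW.
  move/subspace_continuousP : bC => /(_ _ qI) bC'.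
  move=> U /bC'; rewrite /within/= => VU.
  apply: (@filterS _ (nbhs (s, t)) _ _ _ _ (qC _ VU)) => -[s' t'] /= H [s'0 t'0].
  by apply: H; split => //; rewrite mulr_ge0// ltW.
- move=> t t0; have := classK_comp (bK _ (m0 t)) (mulr_gt0 a0 (expR_gt0 (c - t))) K0.
  by [].
- move=> s t t' s0 t0 tt'; rewrite /delayed_KL ltr_leD//.
    by rewrite ltr_pM2r// ltr_pM2l// ltr_expR ltrD2l ltrN2.
  apply: classKL_noninc => //; first by rewrite mulr_ge0 ?ltW.
  by case: (leP 0 (t - h)) => ?; case: (leP 0 (t' - h)) => ?; lra.
- move=> s s0; rewrite /delayed_KL -[X in _ --> X]addr0; apply: cvgD.
    have -> : 0 = a * 0 * s :> R by rewrite mulr0 mul0r.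
    apply: cvgM; last exact: cvg_cst.
    apply: cvgM; first exact: cvg_cst.
    have -> : (fun t => expR (c - t)) = fun t => expR c * expR (- t).
      by apply/funext => t; rewrite expRD.
    rewrite -[X in _ --> X](mulr0 (expR c)); apply: cvgM; first exact: cvg_cst.
    exact: cvgr_expR.
  have Ks : 0 < K * s by rewrite mulr_gt0.
  have bl := blim _ Ks.
  apply/cvgrPdist_lt => e e0.
  have /cvgrPdist_lt/(_ _ e0)[M [_ HM]] := bl.
  (* Beyond this time t - h exceeds M, where the limit of beta applies. *)
  exists (Num.max M 0 + h); split; first exact: num_real.
  move=> t ht /=; apply: HM; rewrite lt_max; apply/orP; right.
  have : M <= Num.max M 0 by rewrite le_max lexx.
  lra.
Qed.

End ComparisonFunctions.

(** * The equivalences, by choice of comparison functions and radii *)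

Theorem mainTheorem1 (R : realType) (r n : nat) (hM : R) (A : set 'rV[R]_r)
    (f : 'rV[R]_r -> (R -> 'rV[R]_n) -> 'rV[R]_n)
    (HH : set (R -> 'rV[R]_r)) (H : R)
    (hM_gt0 : 0 < hM)
    (f_continuous : rhs_continuous hM A f)
    (f_zero : forall a, A a -> f a (cst 0) = 0)
    (f_loc_lipschitz : rhs_locally_lipschitz hM A f)
    (HH_continuous : forall zeta, HH zeta -> {within `[0, +oo[, continuous zeta})
    (HH_invariant : forward_invariant HH)
    (HH_in_A : forall zeta (t : R), HH zeta -> 0 <= t -> A (zeta t))
    (H_gt0 : 0 < H)
    (f_ball_lipschitz :
      rhs_lipschitz_on hM A [set phi | supnorm hM phi <= H] f) :
  [/\ stable hM f (W hM) (Wnorm hM) HH <->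
        stable hM f (C0 hM) (supnorm hM) HH,
      local_UAS hM f (W hM) (Wnorm hM) HH <->
        local_UAS hM f (C0 hM) (supnorm hM) HH,
      local_ES hM f (W hM) (Wnorm hM) HH <->
        local_ES hM f (C0 hM) (supnorm hM) HH &
      rhs_lipschitz_on hM A setT f ->
        (global_UAS hM f (W hM) (Wnorm hM) HH <->
           global_UAS hM f (C0 hM) (supnorm hM) HH) /\
        (global_ES hM f (W hM) (Wnorm hM) HH <->
           global_ES hM f (C0 hM) (supnorm hM) HH)].
Proof.
have [K1 K1_gt0 supK] := @supnorm_le_Wnorm R n hM hM_gt0.
have [rho0 [M [K [rho0_gt0 M0 K0 reg]]]] :=
  regularization_local hM_gt0 f_continuous f_zero H_gt0 f_ball_lipschitz.
have W_of_C0 := @decay_estimate_W_of_C0 R r n hM f HH hM_gt0 K1.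
have C0_of_W := decay_estimate_C0_of_W hM_gt0 f_loc_lipschitz HH_continuous HH_invariant HH_in_A.
have rhoW rho s : (s%:E < (rho / K1)%:E)%E -> ((K1 * s)%:E < rho%:E)%E.
  by rewrite !lte_fin ltr_pdivlMr// mulrC.
(* rho0 allows the regularization, and rho / K keeps the restarted datum within the radius of the W
   estimate. *)
have rhoC rho s : (s%:E < (Num.min rho0 (rho / K))%:E)%E ->
    (s%:E < rho0%:E)%E /\ ((K * s)%:E < rho%:E)%E.
  by rewrite !lte_fin lt_min ltr_pdivlMr// mulrC => /andP[].
have rhoC_gt0 rho : 0 < rho -> 0 < Num.min rho0 (rho / K).
  by move=> rho_gt0; rewrite lt_min rho0_gt0 divr_gt0.
have KL_W beta : classKL beta -> forall s u t, 0 <= u -> u <= K1 * s -> 0 <= t ->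
    beta u t <= delayed_KL 1 0 0 K1 beta s t.
  move=> bKL s u t u0 us t0; rewrite /delayed_KL subr0 max_r//.
  have s0 : 0 <= s by have := le_trans u0 us; rewrite pmulr_rge0.
  apply: le_trans (classKL_le bKL u0 us t0) _.
  by rewrite lerDr !mulr_ge0 ?expR_ge0.
(* The exponent hM - t is nonnegative on the first delay, so M' * exp (hM - t) * s dominates M' * s
   there. *)
have KL_C1 (M' K' : R) beta : 0 < M' -> 0 < K' -> classKL beta ->
    forall s t, 0 <= s -> 0 <= t <= hM -> M' * s <= delayed_KL M' hM hM K' beta s t.
  move=> M'0 K'0 bKL s t s0 /andP[t0 th]; rewrite /delayed_KL.
  apply: (@le_trans _ _ (M' * expR (hM - t) * s)).
    by rewrite ler_wpM2r// ler_peMr ?(ltW M'0)// -expR0 ler_expR subr_ge0.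
  rewrite lerDl; apply: classKL_ge0 => //; last by rewrite le_max lexx.
  by rewrite mulr_ge0// ltW.
have KL_C2 (M' K' : R) beta : 0 < M' -> 0 < K' -> classKL beta ->
    forall s u t, 0 <= u -> u <= K' * s -> hM <= t ->
    beta u (t - hM) <= delayed_KL M' hM hM K' beta s t.
  move=> M'0 K'0 bKL s u t u0 us ht; have th0 : 0 <= t - hM by rewrite subr_ge0.
  have s0 : 0 <= s by have := le_trans u0 us; rewrite pmulr_rge0.
  rewrite /delayed_KL max_r//; apply: le_trans (classKL_le bKL u0 us th0) _.
  by rewrite lerDr !mulr_ge0 ?expR_ge0// ltW.
have ES_W (kappa c : R) : 0 < c -> forall s u t, 0 <= u -> u <= K1 * s -> 0 <= t ->
    exp_decay kappa c u t <= exp_decay kappa (c * K1) s t.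
  move=> c0 s u t u0 us t0; rewrite /exp_decay.
  have -> : c * K1 * expR (- kappa * t) * s = c * expR (- kappa * t) * (K1 * s) by ring.
  by rewrite ler_wpM2l// mulr_ge0 ?expR_ge0// ltW.
(* The factor exp (kappa * hM) pays for the lost delay. M' serves the times up to hM, and c * K' the
   restarted estimate, so the decay rate kappa is unchanged. *)
pose cE M' K' kappa c : R := (M' + c * K') * expR (kappa * hM).
have cE_gt0 M' K' kappa c : 0 < M' -> 0 < K' -> 0 < c -> 0 < cE M' K' kappa c.
  by move=> *; rewrite mulr_gt0 ?expR_gt0// addr_gt0// mulr_gt0.
have ES_C1 (M' K' kappa c : R) : 0 < M' -> 0 < K' -> 0 < kappa -> 0 < c ->
    forall s t, 0 <= s -> 0 <= t <= hM ->
    M' * s <= exp_decay kappa (cE M' K' kappa c) s t.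
  move=> M'0 K'0 k0 c0 s t s0 /andP[t0 th]; rewrite /exp_decay /cE -[_ * expR _ * expR _]mulrA -expRD ler_wpM2r//.
  have cK0 : 0 < c * K' by rewrite mulr_gt0.
  have e1 : 1 <= expR (kappa * hM + - kappa * t).
    by rewrite -expR0 ler_expR mulNr -mulrBr mulr_ge0 ?subr_ge0// ltW.
  nra.
have ES_C2 (M' K' kappa c : R) : 0 < M' -> 0 < K' -> 0 < kappa -> 0 < c ->
    forall s u t, 0 <= u -> u <= K' * s -> hM <= t ->
    exp_decay kappa c u (t - hM) <= exp_decay kappa (cE M' K' kappa c) s t.
  move=> M'0 K'0 k0 c0 s u t u0 us ht; rewrite /exp_decay /cE -[_ * expR _ * expR _]mulrA -expRD.
  have -> : - kappa * (t - hM) = kappa * hM + - kappa * t by ring.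
  set e := expR _; have e0 : 0 <= e by exact: expR_ge0.
  have s0 : 0 <= s by have := le_trans u0 us; rewrite pmulr_rge0.
  apply: (@le_trans _ _ (c * e * (K' * s))); first by rewrite ler_wpM2l// mulr_ge0// ltW.
  have -> : (M' + c * K') * e * s = c * e * (K' * s) + M' * e * s by ring.
  by rewrite lerDl !mulr_ge0// ltW.
split.
- split=> -[alpha [rho [aK rho_gt0 est]]].
  + exists (fun s => M * s + alpha (K * s)), (Num.min rho0 (rho / K)).
    split; [exact: classK_comp|exact: rhoC_gt0|].
    apply: (C0_of_W _ _ _ _ _ _ _ reg _ _ _ est) => [s _|s t s0 _|s u t u0 us _].
    * exact: rhoC.
    * by rewrite lerDl classK_ge0// mulr_ge0// ltW.
    * apply: le_trans (classK_le aK u0 us) _; rewrite lerDr mulr_ge0 ?(ltW M0)//.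
      by have := le_trans u0 us; rewrite pmulr_rge0.
  + exists (fun s => 1 * s + alpha (K1 * s)), (rho / K1).
    split; [exact: classK_comp|by rewrite divr_gt0|].
    apply: (W_of_C0 _ _ _ _ supK _ _ est) => [s _|s u t u0 us _]; first exact: rhoW.
    apply: le_trans (classK_le aK u0 us) _; rewrite lerDr mul1r.
    by have := le_trans u0 us; rewrite pmulr_rge0.
- split=> -[beta [rho [bKL rho_gt0 est]]].
  + exists (delayed_KL M hM hM K beta), (Num.min rho0 (rho / K)).
    split; [by apply: classKL_delayed => //; exact: ltW|exact: rhoC_gt0|].
    apply: (C0_of_W _ _ _ _ _ _ _ reg _ _ _ est); [by move=> s _; exact: rhoC|exact: KL_C1|exact: KL_C2].
  + exists (delayed_KL 1 0 0 K1 beta), (rho / K1).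
    split; [exact: classKL_delayed|by rewrite divr_gt0|].
    by apply: (W_of_C0 _ _ _ _ supK _ _ est); [move=> s _; exact: rhoW|exact: KL_W].
- split=> -[kappa [c [rho [k0 c0 rho_gt0 est]]]].
  + exists kappa, (cE M K kappa c), (Num.min rho0 (rho / K)).
    split; [by []|exact: cE_gt0|exact: rhoC_gt0|].
    apply: (C0_of_W _ _ _ _ _ _ _ reg _ _ _ est); [by move=> s _; exact: rhoC|exact: ES_C1|exact: ES_C2].
  + exists kappa, (c * K1), (rho / K1).
    split; [by []|by rewrite mulr_gt0|by rewrite divr_gt0|].
    by apply: (W_of_C0 _ _ _ _ supK _ _ est); [move=> s _; exact: rhoW|exact: ES_W].
move=> f_lipschitz.
(* Only the regularization is redone: a global Lipschitz constant allows an infinite radius, with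
   its own constants M' and K'. *)
have [M' [K' [M'0 K'0 reg']]] := regularization_global hM_gt0 f_continuous f_zero f_lipschitz.
split; split.
- move=> [beta [bKL est]]; exists (delayed_KL M' hM hM K' beta).
  split; first by apply: classKL_delayed => //; exact: ltW.
  apply: (C0_of_W _ _ _ _ _ _ _ reg' _ _ _ est);
    [by move=> s _ _; split; exact: ltry|exact: KL_C1|exact: KL_C2].
- move=> [beta [bKL est]]; exists (delayed_KL 1 0 0 K1 beta).
  split; first exact: classKL_delayed.
  by apply: (W_of_C0 _ _ _ _ supK _ _ est); [move=> s _ _; exact: ltry|exact: KL_W].
- move=> [kappa [c [k0 c0 est]]]; exists kappa, (cE M' K' kappa c).
  split; [by []|exact: cE_gt0|].
  apply: (C0_of_W _ _ _ _ _ _ _ reg' _ _ _ est);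
    [by move=> s _ _; split; exact: ltry|exact: ES_C1|exact: ES_C2].
- move=> [kappa [c [k0 c0 est]]]; exists kappa, (c * K1).
  split; [by []|by rewrite mulr_gt0|].
  by apply: (W_of_C0 _ _ _ _ supK _ _ est); [move=> s _ _; exact: ltry|exact: ES_W].
Qed.
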